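(* For every integer $k>1$ and every real $r>0$ there exists $l>0$, depending only on $r$ and $k$, such that the following holds. Let $M$ be a hyperbolic 3-manifold with $\mathrm{rank}\,\pi_1(M)=k$ and let $f\colon X\to M$ be a minimal length carrier graph. If every circuit in $X$ has length greater than $r$, then every edge in $X$ has length at least $l$.
   Context: A hyperbolic 3-manifold is $M=\mathbb{H}^3/\Gamma$ for a discrete, torsion-free group $\Gamma<\mathrm{Isom}^+(\mathbb{H}^3)$. The rank of a group is the minimal cardinality of a generating set. A carrier graph for $M$ is a finite (connected) trivalent graph $X$ (loops and multiple edges are allowed) together with a map $f\colon X\to M$ such that $f_*\colon\pi_1(X)\to\pi_1(M)$ is surjective; all carrier graphs are assumed to satisfy $\mathrm{rank}\,\pi_1(X)=\mathrm{rank}\,\pi_1(M)$. The length of an edge $e$ of $X$ (relative to $f$) is the length of the path $f|_e$ in $M$, and $\mathrm{len}_f(X)$ is the sum of the lengths of all the edges of $X$. A minimal length carrier graph is a carrier graph $f\colon X\to M$ such that $\mathrm{len}_f(X)\le\mathrm{len}_g(Y)$ for every carrier graph $g\colon Y\to M$. A circuit in a graph is a simple closed curve in the graph; its length is the sum of the lengths of its edges. *)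

(* Defs.v *)
From HB Require Import structures.
From Stdlib Require Import Relations.
From mathcomp Require Import all_boot all_order all_algebra generic_quotient.
From mathcomp Require Import all_classical all_reals.
From mathcomp Require Import topology ereal normedtype exp numfun.

Set Implicit Arguments.
Unset Strict Implicit.
Unset Printing Implicit Defensive.

Import Order.TTheory GRing.Theory Num.Theory.
Import numFieldNormedType.Exports.

Local Open Scope classical_set_scope.
Local Open Scope ring_scope.
Local Open Scope quotient_scope.

(** Groups are handled as setoids: a set [mem] of representatives, an
    equivalence [eqv] between them, and operations on representatives. The
    group in question is [mem] modulo [eqv]. *)

Section Rank.
Context (G : Type) (mem : set G) (eqv : G -> G -> Prop).
Context (one : G) (mul : G -> G -> G) (inv : G -> G).

(* The letter [(i, true)] stands for the inverse of the i-th generator. *)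
Definition word_value n (g : 'I_n -> G) (w : seq ('I_n * bool)) : G :=
  foldr (fun a x => mul (if a.2 then inv (g a.1) else g a.1) x) one w.

Definition generates n (g : 'I_n -> G) : Prop :=
  (forall i, mem (g i)) /\
  (forall x, mem x -> exists w, eqv x (word_value g w)).

Definition has_rank (n : nat) : Prop :=
  (exists g : 'I_n -> G, generates g) /\
  (forall m (g : 'I_m -> G), generates g -> (n <= m)%N).

End Rank.

(** Paths are functions on [R] of which only the values on [0, 1] matter. *)

Section FundamentalGroup.
Context (R : realType) (T : topologicalType).

Definition is_path (x y : T) (p : R -> T) : Prop :=
  [/\ {within `[0, 1], continuous p}, p 0 = x & p 1 = y].

Definition path_concat (p q : R -> T) : R -> T :=
  fun t => if t <= 2^-1 then p (2 * t) else q (2 * t - 1).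

Definition path_rev (p : R -> T) : R -> T := fun t => p (1 - t).

(* Homotopy relative to the endpoints; [H (s, t)] is at stage [s]. *)
Definition path_homotopic (p q : R -> T) : Prop :=
  exists H : R * R -> T,
    [/\ {within `[0, 1] `*` `[0, 1], continuous H},
        {in `[0, 1], forall t, H (0, t) = p t /\ H (1, t) = q t} &
        {in `[0, 1], forall s, H (s, 0) = p 0 /\ H (s, 1) = p 1}].

Definition pi1_rank (x : T) (n : nat) : Prop :=
  has_rank (is_path x x) path_homotopic (cst x) path_concat path_rev n.

End FundamentalGroup.

(** Finite graphs, with loops and multiple edges. A dart is an edge together
    with a direction of travel; [(e, true)] runs from [target e] to
    [source e]. *)

Record graph := Graph {
  vertex : finType;
  edge : finType;
  source : edge -> vertex;
  target : edge -> vertex }.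

Section Graphs.
Context (X : graph).

Definition dart : Type := (edge X * bool)%type.
Definition dart_src (d : dart) : vertex X :=
  if d.2 then target d.1 else source d.1.
Definition dart_tgt (d : dart) : vertex X :=
  if d.2 then source d.1 else target d.1.
Definition dart_flip (d : dart) : dart := (d.1, ~~ d.2).

Fixpoint is_walk (u v : vertex X) (w : seq dart) : Prop :=
  if w is d :: w' then dart_src d = u /\ is_walk (dart_tgt d) v w' else u = v.

Definition graph_connected : Prop :=
  (0 < #|vertex X|)%N /\ forall u v, exists w, is_walk u v w.

(* A loop contributes 2 to the degree of its vertex. *)
Definition degree (v : vertex X) : nat :=
  (#|[set e | source e == v]%SET| + #|[set e | target e == v]%SET|)%N.

Definition trivalent : Prop := forall v, degree v = 3%N.

Definition backtrack (w w' : seq dart) : Prop :=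
  exists w1 w2 d, w = w1 ++ d :: dart_flip d :: w2 /\ w' = w1 ++ w2.

(* Words that are not walks may occur as intermediate steps. This does not
   identify more walks: deleting backtracks is confluent and preserves
   walks. *)
Definition walk_homotopic : seq dart -> seq dart -> Prop :=
  clos_refl_sym_trans _ backtrack.

Definition walk_rev (w : seq dart) : seq dart := rev (map dart_flip w).

(* Rank of the fundamental group of the graph, taken as its edge-path group:
   closed walks at [v] up to insertion and deletion of backtracks. *)
Definition graph_pi1_rank (v : vertex X) (n : nat) : Prop :=
  has_rank (is_walk v v) walk_homotopic [::] cat walk_rev n.

(* Simple closed curves: no vertex and no edge is visited twice. Distinctness
   of edges excludes going along an edge and back. *)
Definition is_circuit (c : seq dart) : Prop :=
  [/\ c <> [::], exists v, is_walk v v c,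
      uniq (map dart_src c) & uniq (map fst c)].

End Graphs.

Section HyperbolicSpace.
Context (R : realType).

Definition mink (u v : 'cV[R]_4) : R :=
  - (u 0 0 * v 0 0) + \sum_(i < 3) u (lift 0 i) 0 * v (lift 0 i) 0.

Definition hyperboloid : set 'cV[R]_4 := [set v | mink v v = -1 /\ 0 < v 0 0].

Definition H3 : topologicalType := set_type hyperboloid.

Definition arcosh (x : R) : R := ln (x + Num.sqrt (x ^+ 2 - 1)).

(* On the hyperboloid [- mink] is the hyperbolic cosine of the distance. *)
Definition H3_dist (p q : H3) : R := arcosh (- mink (\val p) (\val q)).

(* In this model the isometries are the restrictions of the linear maps
   preserving [mink] and the upper sheet; the orientation-preserving ones are
   those of determinant 1. *)
Definition isom_plus : set 'M[R]_4 := [set A | [/\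
  forall u v, mink (A *m u) (A *m v) = mink u v,
  forall p, hyperboloid p -> hyperboloid (A *m p) &
  \det A = 1]].

Record kleinian := Kleinian {
  kleinian_set : set 'M[R]_4;
  kleinian_isom : kleinian_set `<=` isom_plus;
  kleinian1 : kleinian_set 1;
  kleinianM : forall A B,
    kleinian_set A -> kleinian_set B -> kleinian_set (A * B);
  kleinianV : forall A, kleinian_set A -> kleinian_set A^-1;
  kleinian_discrete : forall A, kleinian_set A ->
    \forall B \near A, kleinian_set B -> B = A;
  kleinian_torsion_free : forall A n, kleinian_set A ->
    (0 < n)%N -> A ^+ n = 1 -> A = 1 }.

End HyperbolicSpace.

Section HyperbolicManifold.
Context (R : realType) (Gamma : kleinian R).

Definition orbit_rel : rel (H3 R) :=
  fun p q => `[< exists2 A, kleinian_set Gamma A & \val q = A *m \val p >].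

Lemma orbit_rel_refl : reflexive orbit_rel.
Proof.
by move=> p; apply/asboolP; exists 1; [exact: kleinian1 | rewrite mul1mx].
Qed.

Lemma isom_plus_unit (A : 'M[R]_4) : isom_plus A -> A \is a GRing.unit.
Proof. by case=> _ _ dA; rewrite unitmxE dA unitr1. Qed.

Lemma orbit_rel_symmetric : symmetric orbit_rel.
Proof.
suff H p q : orbit_rel p q -> orbit_rel q p by move=> p q; apply/idP/idP => /H.
move=> /asboolP[A GA qE]; apply/asboolP; exists A^-1; first exact: kleinianV.
have uA := isom_plus_unit (kleinian_isom GA).
by rewrite qE mulmxA mulVmx ?mul1mx.
Qed.

Lemma orbit_rel_trans : transitive orbit_rel.
Proof.
move=> q p s /asboolP[A GA qE] /asboolP[B GB sE]; apply/asboolP.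
by exists (B * A); [exact: kleinianM | rewrite sE qE mulmxA].
Qed.

Definition orbit_equiv : equiv_rel (H3 R) :=
  EquivRel orbit_rel orbit_rel_refl orbit_rel_symmetric orbit_rel_trans.

Definition manifold : topologicalType :=
  quotient_topology {eq_quot orbit_equiv}.

Definition manifold_proj (p : H3 R) : manifold :=
  \pi_{eq_quot orbit_equiv} p.

Definition manifold_dist (x y : manifold) : R :=
  inf [set H3_dist pq.1 pq.2 | pq in
         [set pq : H3 R * H3 R |
           manifold_proj pq.1 = x /\ manifold_proj pq.2 = y]].

(* A partition 0 < s_0 < ... < s_(m-1) = 1 is given by the sequence of the
   s_i. *)
Definition path_length (p : R -> manifold) : \bar R :=
  ereal_sup [set (\sum_(i < size s)
                    manifold_dist (p (nth 0 (0 :: s) i)) (p (nth 0 s i)))%:E |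
             s in itv_partition 0 1].

(** A map of a graph to the manifold is given by its values at the vertices
    and by the paths along which it maps the edges. *)

Section GraphMap.
Context (X : graph) (fv : vertex X -> manifold) (fe : edge X -> R -> manifold).

Definition dart_path (d : dart X) : R -> manifold :=
  if d.2 then path_rev (fe d.1) else fe d.1.

Definition walk_path (v : vertex X) (w : seq (dart X)) : R -> manifold :=
  foldr (fun d p => path_concat (dart_path d) p) (cst (fv v)) w.

Definition pi1_surjective : Prop :=
  forall v (p : R -> manifold), is_path (fv v) (fv v) p ->
    exists w, is_walk v v w /\ path_homotopic p (walk_path v w).

End GraphMap.

Record carrier_graph := CarrierGraph {
  cg_graph :> graph;
  cg_vertex : vertex cg_graph -> manifold;
  cg_edge : edge cg_graph -> R -> manifold;
  cg_path : forall e,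
    is_path (cg_vertex (source e)) (cg_vertex (target e)) (cg_edge e);
  cg_connected : graph_connected cg_graph;
  cg_trivalent : trivalent cg_graph;
  cg_surjective : pi1_surjective cg_vertex cg_edge;
  (* Stated so as to be meaningful also when the rank of the manifold is
     infinite, in which case there is no carrier graph. *)
  cg_rank : forall v n,
    graph_pi1_rank v n <-> pi1_rank R (cg_vertex v) n }.

Definition edge_length (X : carrier_graph) (e : edge X) : \bar R :=
  path_length (cg_edge e).

Definition graph_length (X : carrier_graph) : \bar R :=
  (\sum_(e : edge X) edge_length e)%E.

Definition minimal_length (X : carrier_graph) : Prop :=
  forall Y : carrier_graph, (graph_length X <= graph_length Y)%E.

Definition circuit_length (X : carrier_graph) (c : seq (dart X)) : \bar R :=
  (\sum_(d <- c) edge_length d.1)%E.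

End HyperbolicManifold.

(* Main.v *)
Require Import Defs.
From Stdlib Require Import Relations.
From mathcomp Require Import all_boot all_order all_algebra generic_quotient.
From mathcomp Require Import fingroup perm.
From mathcomp Require Import all_classical all_reals.
From mathcomp Require Import topology ereal normedtype exp numfun sequences realfun.
From mathcomp Require Import zify ring lra.

Set Implicit Arguments.
Unset Strict Implicit.
Unset Printing Implicit Defensive.

Import Order.TTheory GRing.Theory Num.Theory.
Import numFieldNormedType.Exports.

Local Open Scope classical_set_scope.
Local Open Scope ring_scope.
Local Open Scope quotient_scope.

(** Why short edges cannot occur.

    Suppose that some edge of a minimal length carrier graph is extremely
    short. The rank bounds the dimension of the cycle space modulo 2, so a
    trivalent graph of rank [k] has at most [3 * k] edges ([card_edges]), and
    among their lengths there is a gap ([scale_gap]): for some [s] every edge is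
    either shorter than [s] or at least as long as [K * s], with [K] a large
    multiple of [k ^ 2]. Since every circuit is longer than [r], the edges
    shorter than [s] form a forest. A component [C] of it that contains an edge
    has two leaves, and each leaf carries two long half-edges; so seen at the scale
    [K * s] the component looks like a single point from which at least four
    long legs issue.

    Such a star is not efficient. Of four unit vectors in a Euclidean space some
    two have inner product at least [- 1 / 3], and joining these two legs to a
    new stem along their bisector saves [2 / sqrt 3 - 1 > 0] times the length of
    the stem, to first order ([star_split]). The gain is a definite fraction of
    [K * s], whereas collapsing [C] to a point costs only a multiple of
    [k ^ 2 * s] ([no_short_edge]). Combinatorially one reattaches two of the long
    half-edges at a leaf of [C] and moves that leaf ([surgery]). Because the
    short edges of [C] form a tree, the old and the new graph can be mapped to
    each other by sliding half-edges along the tree, and these maps are mutually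
    inverse on edge-path groups ([to_of_rewire]); so the new graph is again a
    carrier graph of the right rank, shorter than the minimal one.

    All lengths are computed in hyperbolic space. A discrete torsion-free group
    moves every point by an amount bounded below ([injectivity_radius]), so paths
    lift to hyperbolic space and are at least as long as the distance between
    the ends of the lift ([path_lifting]); and two paths whose lifts have the
    same ends are homotopic, along geodesic segments ([lifts_homotopic]). A
    mapped graph is thus described by lifts of its vertices and by one deck
    transformation for each edge ([developed]). The vertices can be moved at will
    and the edges straightened without losing the surjectivity on fundamental
    groups ([competitor_exists]). In particular each edge of a minimal graph is
    exactly as long as its straightened lift ([minimal_edge_length]). *)

(** * Hyperbolic functions *)

Section HyperbolicFunctions.
Context (R : realType).
Implicit Types x y s t : R.

Definition ch x : R := (expR x + expR (- x)) / 2.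
Definition sh x : R := (expR x - expR (- x)) / 2.

Lemma ch0 : ch 0 = 1.
Proof. by rewrite /ch oppr0 expR0; lra. Qed.

Lemma chN x : ch (- x) = ch x.
Proof. by rewrite /ch opprK addrC. Qed.

Lemma chB x y : ch (x - y) = ch x * ch y - sh x * sh y.
Proof.
rewrite /ch /sh opprB !expRD !expRN.
have := gt_eqF (expR_gt0 x); have := gt_eqF (expR_gt0 y).
by move=> /negbT ? /negbT ?; field; apply/andP.
Qed.

Lemma chD x y : ch (x + y) = ch x * ch y + sh x * sh y.
Proof.
rewrite /ch /sh opprD !expRD !expRN.
have := gt_eqF (expR_gt0 x); have := gt_eqF (expR_gt0 y).
by move=> /negbT ? /negbT ?; field; apply/andP.
Qed.

Lemma ch2sh2 x : ch x ^+ 2 = 1 + sh x ^+ 2.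
Proof.
by have := chB x x; rewrite subrr ch0 !expr2 => /eqP; rewrite eq_sym subr_eq => /eqP.
Qed.

Lemma sh_ge0 x : 0 <= x -> 0 <= sh x.
Proof.
move=> x0; have : expR (- x) <= expR x by rewrite ler_expR; lra.
by rewrite /sh; lra.
Qed.

Lemma sh_gt0 x : 0 < x -> 0 < sh x.
Proof.
move=> x0; have : expR (- x) < expR x by rewrite ltr_expR; lra.
by rewrite /sh; lra.
Qed.

Lemma ch_gt0 x : 0 < ch x.
Proof. by rewrite /ch; have := expR_gt0 x; have := expR_gt0 (- x); lra. Qed.

Lemma ch_ge1 x : 1 <= ch x.
Proof.
have := ch2sh2 x; have := ch_gt0 x; have := sqr_ge0 (sh x); nra.
Qed.

Lemma ch_le x y : 0 <= x -> x <= y -> ch x <= ch y.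
Proof.
move=> x0 xy; have -> : y = x + (y - x) by ring.
rewrite chD; have := ch_ge1 (y - x); have := ch_gt0 x.
have : 0 <= sh x * sh (y - x) by apply: mulr_ge0; apply: sh_ge0; lra.
nra.
Qed.

Lemma ch_lt x y : 0 <= x -> x < y -> ch x < ch y.
Proof.
move=> x0 xy; have -> : y = x + (y - x) by ring.
have d0 : 0 < y - x by lra.
have C1 : 1 < ch (y - x).
  rewrite -(@ltr_pXn2r _ 2) ?nnegrE ?(ltW (ch_gt0 _))//.
  by rewrite expr1n ch2sh2 ltrDl exprn_gt0 ?sh_gt0.
have : 0 <= sh x * sh (y - x) by apply: mulr_ge0; apply: sh_ge0; lra.
have h : ch x < ch x * ch (y - x) by rewrite ltr_pMr// ch_gt0.
by rewrite (chD x (y - x)); lra.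
Qed.

Lemma ch_leP x y : 0 <= x -> 0 <= y -> ch x <= ch y -> x <= y.
Proof. by move=> x0 y0; apply: contraTT; rewrite -!ltNge; apply: ch_lt. Qed.

Lemma ch_inj x y : 0 <= x -> 0 <= y -> ch x = ch y -> x = y.
Proof.
move=> x0 y0 e; apply/eqP; rewrite eq_le.
by apply/andP; split; apply: ch_leP => //; rewrite e.
Qed.

Lemma arcosh_ge0 x : 1 <= x -> 0 <= arcosh x.
Proof.
by move=> x1; apply: ln_ge0; have := sqrtr_ge0 (x ^+ 2 - 1); lra.
Qed.

Lemma arcoshK x : 1 <= x -> ch (arcosh x) = x.
Proof.
move=> x1; rewrite /ch /arcosh; set q := Num.sqrt _.
have q0 : 0 <= q by apply: sqrtr_ge0.
have qq : q ^+ 2 = x ^+ 2 - 1 by rewrite sqr_sqrtr //; nra.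
rewrite expRN lnK ?posrE; last lra.
have n0 : x + q != 0 by rewrite gt_eqF//; lra.
have -> : (x + q)^-1 = x - q by apply: (mulfI n0); rewrite mulfV//; lra.
by lra.
Qed.

(** The bound [1 + x / 2 <= expR (x / 2)], once squared, gives the exponential
    up to an error of second order. *)
Lemma sh_ge x : 0 <= x -> x <= 2^-1 -> x - x ^+ 2 / 4 <= sh x.
Proof.
move=> x0 xh; rewrite /sh expRN.
have h : 1 + x / 2 <= expR (x / 2) := expR_ge1Dx _.
have e : expR x = expR (x / 2) ^+ 2 by rewrite expr2 -expRD; congr expR; lra.
have e1 : (1 + x / 2) ^+ 2 <= expR x.
  by rewrite e; rewrite ler_pXn2r// ?nnegrE; have := expR_gt0 (x/2); lra.
have q0 : 0 < (1 + x / 2) ^+ 2 by apply: exprn_gt0; lra.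
have : (expR x)^-1 <= ((1 + x / 2) ^+ 2)^-1 by rewrite lef_pV2// posrE expR_gt0.
have : ((1 + x / 2) ^+ 2)^-1 <= 1 - x + 3 / 4 * x ^+ 2.
  rewrite -[leLHS]mul1r ler_pdivrMr//.
  have : 0 <= x ^+ 3 by apply: exprn_ge0.
  have : 0 <= x ^+ 4 by apply: exprn_ge0.
  have -> : (1 - x + 3 / 4 * x ^+ 2) * (1 + x / 2) ^+ 2 =
    1 + x ^+ 3 * (1 / 2) + x ^+ 4 * (3 / 16) by field.
  lra.
lra.
Qed.

Lemma sh_le x : 0 <= x -> x <= 2^-1 -> sh x <= x + x ^+ 2.
Proof.
move=> x0 xh; rewrite /sh.
have h1 := expR_ge1Dx (- x).
have e0 := expR_gt0 x.
have h2 : expR x <= 1 + x + 2 * x ^+ 2.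
  have : expR x * expR (- x) = 1 by rewrite -expRD subrr expR0.
  move=> e; have : expR x * (1 - x) <= 1 by rewrite -e ler_pM2l//; lra.
  move=> {}e; have : (1 + x + 2 * x ^+ 2) * (1 - x) >= 1.
    have -> : (1 + x + 2 * x ^+ 2) * (1 - x) = 1 + x ^+ 2 * (1 - 2 * x) by ring.
    have : 0 <= x ^+ 2 * (1 - 2 * x) by apply: mulr_ge0; [exact: sqr_ge0|lra].
    lra.
  move=> e2; rewrite -(@ler_pM2r _ (1 - x)); lra.
lra.
Qed.

Lemma ch_small x : 0 <= x -> x <= 2^-1 -> ch x <= 1 + x ^+ 2.
Proof.
move=> x0 xh.
have -> : ch x = 1 + 2 * sh (x / 2) ^+ 2.
  have {1}-> : x = x / 2 + x / 2 by lra.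
  by rewrite chD -!expr2 ch2sh2; ring.
have := @sh_le (x / 2); have := @sh_ge0 (x / 2).
move=> /(_ ltac:(lra)) a /(_ ltac:(lra) ltac:(lra)) b.
have c : sh (x / 2) <= 5 / 8 * x.
  have : x ^+ 2 <= 2^-1 * x by rewrite expr2 ler_wpM2r.
  lra.
have : sh (x / 2) ^+ 2 <= (5 / 8 * x) ^+ 2.
  by rewrite ler_pXn2r// nnegrE; lra.
by have := sqr_ge0 x; lra.
Qed.

End HyperbolicFunctions.

(** * The hyperboloid as a geodesic metric space *)

Lemma ord4_cases (i : 'I_4) : [\/ i = 0, i = lift 0 0, i = lift 0 1 |
  i = lift 0 (lift ord0 (lift ord0 ord0))].
Proof.
case: i => -[|[|[|[|//]]]] h; [apply: Or41|apply: Or42|apply: Or43|apply: Or44];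
  exact/val_inj.
Qed.

Section Minkowski.
Context (R : realType).
Implicit Types (u v w a b c : 'cV[R]_4).

Lemma minkE u v : mink u v = - (u 0 0 * v 0 0) +
  (u (lift 0 0) 0 * v (lift 0 0) 0 + u (lift 0 1) 0 * v (lift 0 1) 0
   + u (lift 0 (lift 0 (lift 0 ord0))) 0 * v (lift 0 (lift 0 (lift 0 ord0))) 0).
Proof.
rewrite /mink !big_ord_recl big_ord0 addr0.
have -> : lift ord0 (ord0 : 'I_2) = 1 :> 'I_3 by apply/val_inj.
by rewrite !addrA.
Qed.

Lemma minkC u v : mink u v = mink v u.
Proof. by rewrite !minkE; ring. Qed.

Lemma minkDl u v w : mink (u + v) w = mink u w + mink v w.
Proof. by rewrite !minkE !mxE; ring. Qed.

Lemma minkZl (x : R) u w : mink (x *: u) w = x * mink u w.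
Proof. by rewrite !minkE !mxE; ring. Qed.

Lemma minkDr u v w : mink w (u + v) = mink w u + mink w v.
Proof. by rewrite !(minkC w) minkDl. Qed.

Lemma minkZr (x : R) u w : mink w (x *: u) = x * mink w u.
Proof. by rewrite !(minkC w) minkZl. Qed.

Lemma minkNl u w : mink (- u) w = - mink u w.
Proof. by rewrite -scaleN1r minkZl mulN1r. Qed.

Lemma minkNr u w : mink w (- u) = - mink w u.
Proof. by rewrite !(minkC w) minkNl. Qed.

Definition minkL := (minkDl, minkDr, minkNl, minkNr, minkZl, minkZr).

(** The tangent spaces of the hyperboloid are Euclidean: by Lagrange's identity,
    orthogonality to [o] makes the spatial part of [a] dominate. *)
Lemma mink_tangent a o : mink o o = -1 -> mink a o = 0 ->
  0 <= mink a a /\ (mink a a = 0 -> a = 0).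
Proof.
rewrite !minkE.
set a0 := a 0 0; set a1 := a _ 0; set a2 := a _ 0; set a3 := a _ 0.
set o0 := o 0 0; set o1 := o _ 0; set o2 := o _ 0; set o3 := o _ 0.
move=> oo ao.
have e : (a1 * a1 + a2 * a2 + a3 * a3) * (o0 * o0) - (a0 * a0) * (o0 * o0) =
    (a1 * o2 - a2 * o1) ^+ 2 + (a1 * o3 - a3 * o1) ^+ 2
    + (a2 * o3 - a3 * o2) ^+ 2 + (a1 ^+ 2 + a2 ^+ 2 + a3 ^+ 2).
  have -> : o0 * o0 = 1 + (o1 * o1 + o2 * o2 + o3 * o3) by lra.
  have aoE : a0 * o0 = a1 * o1 + a2 * o2 + a3 * o3 by lra.
  have : a0 * a0 * (o0 * o0) = (a1 * o1 + a2 * o2 + a3 * o3) ^+ 2.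
    by rewrite -aoE; ring.
  have -> : o0 * o0 = 1 + (o1 * o1 + o2 * o2 + o3 * o3) by lra.
  by move=> ->; ring.
have o00 : 0 < o0 * o0.
  have := sqr_ge0 o1; have := sqr_ge0 o2; have := sqr_ge0 o3.
  by rewrite !expr2; lra.
pose n := a1 ^+ 2 + a2 ^+ 2 + a3 ^+ 2.
have n0 : 0 <= n by rewrite /n !addr_ge0// sqr_ge0.
have nle : n <= (- (a0 * a0) + (a1 * a1 + a2 * a2 + a3 * a3)) * (o0 * o0).
  have -> : (- (a0 * a0) + (a1 * a1 + a2 * a2 + a3 * a3)) * (o0 * o0) =
    (a1 * a1 + a2 * a2 + a3 * a3) * (o0 * o0) - a0 * a0 * (o0 * o0) by ring.
  rewrite e lerDr.
  by rewrite !addr_ge0// sqr_ge0.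
split; first by rewrite -(pmulr_lge0 _ o00) (le_trans n0).
move=> z; move: nle; rewrite z mul0r => nle.
have {}n0 : n = 0 by apply/eqP; rewrite eq_le nle.
have s1 := sqr_ge0 a1; have s2 := sqr_ge0 a2; have s3 := sqr_ge0 a3.
have a1z : a1 = 0.
  by apply/eqP; rewrite -sqrf_eq0 eq_le s1 andbT; move: n0; rewrite /n; lra.
have a2z : a2 = 0.
  by apply/eqP; rewrite -sqrf_eq0 eq_le s2 andbT; move: n0; rewrite /n; lra.
have a3z : a3 = 0.
  by apply/eqP; rewrite -sqrf_eq0 eq_le s3 andbT; move: n0; rewrite /n; lra.
have a0z : a0 = 0.
  by apply/eqP; rewrite -sqrf_eq0 expr2; move: z; rewrite a1z a2z a3z; lra.
apply/colP => i; rewrite mxE.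
by case: (ord4_cases i) => ->.
Qed.

Lemma mink_tangent_ge0 a o : mink o o = -1 -> mink a o = 0 -> 0 <= mink a a.
Proof. by move=> oo ao; case: (mink_tangent oo ao). Qed.

(** The square of [mink b b *: a - mink a b *: b] is nonnegative. *)
Lemma mink_tangent_CS a b o : mink o o = -1 -> mink a o = 0 -> mink b o = 0 ->
  mink a b ^+ 2 <= mink a a * mink b b.
Proof.
move=> oo ao bo; have [b0 bz] := mink_tangent oo bo.
have [/bz->|bn0] := eqVneq (mink b b) 0.
  by rewrite -(scale0r (0 : 'cV[R]_4)) !minkL !mul0r expr0n mulr0.
have bgt : 0 < mink b b by rewrite lt0r bn0.
have : 0 <= mink (mink b b *: a - mink a b *: b) (mink b b *: a - mink a b *: b).
  by apply: (mink_tangent_ge0 oo); rewrite !minkL ao bo; ring.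
have -> : mink (mink b b *: a - mink a b *: b) (mink b b *: a - mink a b *: b) =
  mink b b * (mink a a * mink b b - mink a b ^+ 2).
  by rewrite !minkL (minkC b a); ring.
by rewrite pmulr_rge0// subr_ge0.
Qed.

Lemma hyperboloid_ge1 a : hyperboloid a -> 1 <= a 0 0.
Proof.
case; rewrite minkE => e a0.
have := sqr_ge0 (a (lift 0 0) 0); have := sqr_ge0 (a (lift 0 1) 0).
have := sqr_ge0 (a (lift 0 (lift 0 (lift 0 ord0))) 0).
rewrite !expr2 -(@ler_pXn2r _ 2) ?nnegrE ?(ltW a0)// expr1n expr2; lra.
Qed.

(** Reverse Cauchy-Schwarz inequality: project [a] to the tangent space at [b]. *)
Lemma mink_sqr_ge1 a b : mink a a = -1 -> mink b b = -1 -> 1 <= mink a b ^+ 2.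
Proof.
move=> aa bb.
have := @mink_tangent_ge0 (a + mink a b *: b) b bb.
rewrite !minkL bb aa (minkC b a) => /(_ ltac:(ring)).
by lra.
Qed.

(** The ordinary Cauchy-Schwarz inequality for the spatial parts gives the
    sign. *)
Lemma mink_le_N1 a b : hyperboloid a -> hyperboloid b -> 1 <= - mink a b.
Proof.
move=> ha hb; have [aa a0] := ha; have [bb b0] := hb.
have m1 := mink_sqr_ge1 aa bb.
suff : mink a b < 0.
  move=> m0; rewrite -(@ler_pXn2r _ 2) ?nnegrE// ?expr1n ?sqrrN//.
  lra.
move: aa bb; rewrite !minkE.
set t := a 0 0; set x := a _ 0; set y := a _ 0; set z := a _ 0.
set t' := b 0 0; set x' := b _ 0; set y' := b _ 0; set z' := b _ 0.
move=> aa bb.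
rewrite addrC subr_lt0.
have := sqr_ge0 (x * y' - y * x'); have := sqr_ge0 (x * z' - z * x').
have := sqr_ge0 (y * z' - z * y') => h1 h2 h3.
have tt : 0 < t * t' by apply: mulr_gt0.
rewrite ltNge; apply/negP => le.
have : (t * t') ^+ 2 <= (x * x' + y * y' + z * z') ^+ 2.
  by rewrite ler_pXn2r// nnegrE; lra.
have -> : (t * t') ^+ 2 = (t * t) * (t' * t') by ring.
have -> : t * t = 1 + (x * x + y * y + z * z) by lra.
have -> : t' * t' = 1 + (x' * x' + y' * y' + z' * z') by lra.
have s1 := sqr_ge0 x; have s2 := sqr_ge0 y; have s3 := sqr_ge0 z.
have t1 := sqr_ge0 x'; have t2 := sqr_ge0 y'; have t3 := sqr_ge0 z'.
lra.
Qed.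

(** A unit timelike vector in the other sheet would have positive product with
    [a]. *)
Lemma hyperboloid_sheet a v : hyperboloid a -> mink v v = -1 -> mink v a < 0 ->
  hyperboloid v.
Proof.
move=> ha vv va; split=> //; rewrite ltNge; apply/negP => v0.
have [vz|vn] := eqVneq (v 0 0) 0.
  move: vv; rewrite minkE vz.
  have := sqr_ge0 (v (lift 0 0) 0); have := sqr_ge0 (v (lift 0 1) 0).
  have := sqr_ge0 (v (lift 0 (lift 0 (lift 0 ord0))) 0).
  rewrite !expr2; lra.
have : 1 <= - mink (- v) a.
  apply: mink_le_N1 => //; split; first by rewrite !minkL opprK.
  by rewrite mxE oppr_gt0 lt_neqAle vn.
by rewrite !minkL; lra.
Qed.

(** Defined on all vectors, so that points given by formulas need not be packaged
    as elements of [H3]. *)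
Definition hdist a b : R := arcosh (- mink a b).

Lemma hdistC a b : hdist a b = hdist b a.
Proof. by rewrite /hdist minkC. Qed.

Lemma hdist_ge0 a b : hyperboloid a -> hyperboloid b -> 0 <= hdist a b.
Proof. by move=> ha hb; apply: arcosh_ge0; apply: mink_le_N1. Qed.

Lemma ch_hdist a b : hyperboloid a -> hyperboloid b -> ch (hdist a b) = - mink a b.
Proof. by move=> ha hb; rewrite arcoshK// mink_le_N1. Qed.

Lemma hdist_le a b (t : R) : hyperboloid a -> hyperboloid b -> 0 <= t ->
  - mink a b <= ch t -> hdist a b <= t.
Proof.
by move=> ha hb t0 h; apply: ch_leP => //; rewrite ?hdist_ge0// ch_hdist.
Qed.

Lemma hdist_eq a b (t : R) : hyperboloid a -> hyperboloid b -> 0 <= t ->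
  - mink a b = ch t -> hdist a b = t.
Proof.
by move=> ha hb t0 h; apply: ch_inj => //; rewrite ?hdist_ge0// ch_hdist.
Qed.

Lemma hdistxx a : hyperboloid a -> hdist a a = 0.
Proof. by move=> ha; apply: hdist_eq => //; rewrite ch0 (proj1 ha) opprK. Qed.

Lemma hdist0_eq a b : hyperboloid a -> hyperboloid b -> hdist a b = 0 -> a = b.
Proof.
move=> ha hb d; have := ch_hdist ha hb; rewrite d ch0 => e.
have [aa _] := ha; have [bb _] := hb.
have [] := @mink_tangent (a - b) b bb; first by rewrite !minkL bb; lra.
move=> _ /(_ _)/eqP; rewrite subr_eq0 => h; apply/eqP/h.
by rewrite !minkL bb aa (minkC b a); lra.
Qed.

(** By the Cauchy-Schwarz inequality on the tangent space at the middle
    point. *)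
Lemma hdist_triangle b a c : hyperboloid a -> hyperboloid b -> hyperboloid c ->
  hdist a c <= hdist a b + hdist b c.
Proof.
move=> ha hb hc; have [aa _] := ha; have [bb _] := hb; have [cc _] := hc.
have ab0 := hdist_ge0 ha hb; have bc0 := hdist_ge0 hb hc.
apply: hdist_le => //; first by rewrite addr_ge0.
rewrite chD !ch_hdist//.
have := @mink_tangent_CS (a + mink a b *: b) (c + mink b c *: b) b bb.
rewrite !minkL bb aa cc (minkC b a) (minkC c b).
move=> /(_ ltac:(ring) ltac:(ring)).
set m := mink a b; set n := mink b c; set p := mink a c => h.
have e1 : sh (hdist a b) ^+ 2 = m ^+ 2 - 1.
  by rewrite -[m ^+ 2]sqrrN -ch_hdist// ch2sh2 addrC addKr.
have e2 : sh (hdist b c) ^+ 2 = n ^+ 2 - 1.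
  by rewrite -[n ^+ 2]sqrrN -ch_hdist// ch2sh2 addrC addKr.
have s0 : 0 <= sh (hdist a b) * sh (hdist b c) by rewrite mulr_ge0// sh_ge0.
have : (p + m * n) ^+ 2 <= (sh (hdist a b) * sh (hdist b c)) ^+ 2.
  by rewrite exprMn e1 e2; clear -h; lra.
clear e1 e2 h; set S := sh _ * sh _ in s0 *; rewrite -[leRHS]real_normK ?num_real//.
move=> hS; have : `|p + m * n| <= S.
  by rewrite -(ger0_norm s0) -(@ler_pXn2r _ 2) ?nnegrE// real_normK ?num_real//.
by rewrite ler_norml => /andP[+ _]; clear; lra.
Qed.

(** Arc length parametrization, rescaled to the unit interval, of the geodesic
    from [a] to [b]. *)
Definition geodesic a b (t : R) : 'cV[R]_4 :=
  let D := hdist a b in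
  if D == 0 then a else
    (sh D)^-1 *: (sh ((1 - t) * D) *: a + sh (t * D) *: b).

Lemma mink_geodesic a b (s t : R) : hyperboloid a -> hyperboloid b ->
  mink (geodesic a b s) (geodesic a b t) = - ch ((s - t) * hdist a b).
Proof.
move=> ha hb; have [aa _] := ha; have [bb _] := hb; rewrite /geodesic.
have [->|D0] := eqVneq; first by rewrite mulr0 ch0.
have Dgt : 0 < hdist a b by rewrite lt0r D0 hdist_ge0.
have shn : sh (hdist a b) != 0 by rewrite gt_eqF ?sh_gt0.
rewrite !minkL aa bb (minkC b a) -[mink a b]opprK -ch_hdist//.
set D := hdist a b in Dgt shn *.
have -> : (1 - s) * D = D - s * D by ring.
have -> : (1 - t) * D = D - t * D by ring.
have -> : (s - t) * D = s * D - t * D by ring.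
have hE x : expR (- x) = (expR x)^-1 :> R by rewrite expRN.
have E0 x : expR x != 0 :> R by rewrite gt_eqF ?expR_gt0.
move: shn; rewrite /ch /sh !opprB !expRD !hE => shn.
field; rewrite !E0 /=.
apply: contra shn => /eqP h; apply/eqP.
apply: (mulfI (E0 D)); rewrite mulr0 mulrA mulrBr divff ?E0//.
by rewrite -expr2 h mul0r.
Qed.

Lemma geodesic0 a b : hyperboloid a -> hyperboloid b -> geodesic a b 0 = a.
Proof.
move=> ha hb; rewrite /geodesic; have [//|D0] := eqVneq.
have Dgt : 0 < hdist a b by rewrite lt0r D0 hdist_ge0.
have shn : sh (hdist a b) != 0 by rewrite gt_eqF ?sh_gt0.
rewrite subr0 mul1r mul0r {3}/sh oppr0 subrr mul0r scale0r addr0 scalerA.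
by rewrite mulVf// scale1r.
Qed.

Lemma geodesic1 a b : hyperboloid a -> hyperboloid b -> geodesic a b 1 = b.
Proof.
move=> ha hb; rewrite /geodesic; have [e|D0] := eqVneq; first exact: hdist0_eq.
have Dgt : 0 < hdist a b by rewrite lt0r D0 hdist_ge0.
have shn : sh (hdist a b) != 0 by rewrite gt_eqF ?sh_gt0.
rewrite subrr mul1r mul0r {2}/sh oppr0 subrr mul0r scale0r add0r scalerA.
by rewrite mulVf// scale1r.
Qed.

Lemma geodesicP a b t : hyperboloid a -> hyperboloid b ->
  hyperboloid (geodesic a b t).
Proof.
move=> ha hb; apply: (hyperboloid_sheet ha).
  by rewrite mink_geodesic// subrr mul0r ch0.
by rewrite -{2}(geodesic0 ha hb) mink_geodesic// oppr_lt0 ch_gt0.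
Qed.

Lemma hdist_geodesic a b (s t : R) : hyperboloid a -> hyperboloid b ->
  s <= t -> hdist (geodesic a b s) (geodesic a b t) = (t - s) * hdist a b.
Proof.
move=> ha hb st; apply: hdist_eq; [exact: geodesicP..| |].
  by rewrite mulr_ge0 ?hdist_ge0// subr_ge0.
by rewrite mink_geodesic// opprK -chN; congr ch; ring.
Qed.

Lemma isom_hyperboloid (A : 'M[R]_4) a :
  isom_plus A -> hyperboloid a -> hyperboloid (A *m a).
Proof. by case=> _ h _; exact: h. Qed.

Lemma isom_hdist (A : 'M[R]_4) a b :
  isom_plus A -> hdist (A *m a) (A *m b) = hdist a b.
Proof. by case=> h _ _; rewrite /hdist h. Qed.

(** Projection to the hyperboloid along rays; it turns convex combinations into
    points between the two given ones. *)
Definition hproj v : 'cV[R]_4 := (Num.sqrt (- mink v v))^-1 *: v.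

Definition segment a b (s : R) : 'cV[R]_4 := hproj ((1 - s) *: a + s *: b).

Lemma mink_convex a b s : hyperboloid a -> hyperboloid b -> 0 <= s -> s <= 1 ->
  1 <= - mink ((1 - s) *: a + s *: b) ((1 - s) *: a + s *: b).
Proof.
move=> ha hb s0 s1; have m := mink_le_N1 ha hb.
rewrite !minkL (proj1 ha) (proj1 hb) (minkC b a).
have : 0 <= s * (1 - s) * (- mink a b - 1).
  by apply: mulr_ge0; [apply: mulr_ge0|]; lra.
lra.
Qed.

Lemma segmentP a b s : hyperboloid a -> hyperboloid b -> 0 <= s -> s <= 1 ->
  hyperboloid (segment a b s).
Proof.
move=> ha hb s0 s1; have m := mink_convex ha hb s0 s1.
rewrite /segment /hproj; set v := (1 - s) *: a + _ in m *.
have q0 : 0 < Num.sqrt (- mink v v) by rewrite sqrtr_gt0; lra.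
split.
  rewrite minkZl minkZr mulrA; set q := Num.sqrt _ in q0 *.
  have qq : q * q = - mink v v by rewrite -expr2 sqr_sqrtr//; lra.
  by rewrite -invfM qq -[X in _ * X]opprK mulrN mulVf// gt_eqF//; lra.
rewrite mxE mulr_gt0// ?invr_gt0// !mxE.
have a1 := hyperboloid_ge1 ha; have b1 := hyperboloid_ge1 hb.
have : 0 <= s * b 0 0 by apply: mulr_ge0; lra.
have : 0 <= (1 - s) * a 0 0 by apply: mulr_ge0; lra.
have [->|] := eqVneq s 0; first by lra.
move=> sn; have sp : 0 < s by rewrite lt0r sn.
have : 0 < s * b 0 0 by apply: mulr_gt0; lra.
lra.
Qed.

Lemma segment_same a s : hyperboloid a -> segment a a s = a.
Proof.
case=> aa _; rewrite /segment /hproj -scalerDl subrK scale1r aa opprK sqrtr1.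
by rewrite invr1 scale1r.
Qed.

Lemma segment0 a b : hyperboloid a -> segment a b 0 = a.
Proof.
case=> aa _; rewrite /segment /hproj subr0 scale1r scale0r addr0 aa opprK sqrtr1.
by rewrite invr1 scale1r.
Qed.

Lemma segment1 a b : hyperboloid b -> segment a b 1 = b.
Proof.
case=> bb _; rewrite /segment /hproj subrr scale1r scale0r add0r bb opprK sqrtr1.
by rewrite invr1 scale1r.
Qed.

End Minkowski.

(** * Splitting a star with four legs *)

Section Star.
Context (R : realType).
Implicit Types (o a b c d : 'cV[R]_4).

(** The sum of the four tangent vectors at [o] towards the [x i] has nonnegative
    square; the bound is the average over the six pairs. *)
Lemma star_close_pair o (x : 'I_4 -> 'cV[R]_4) (C : R) :
  mink o o = -1 -> (forall i, mink (x i) (x i) = -1) ->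
  (forall i, mink (x i) o = - C) ->
  exists i j, i != j /\ (1 - 4 * C ^+ 2) / 3 <= mink (x i) (x j).
Proof.
move=> oo xx xo; apply/not_existsP => h.
have {}h i j : i != j -> mink (x i) (x j) < (1 - 4 * C ^+ 2) / 3.
  by move=> ij; rewrite ltNge; apply/negP => l; apply: (h i); exists j.
pose i0 : 'I_4 := inord 0; pose i1 : 'I_4 := inord 1.
pose i2 : 'I_4 := inord 2; pose i3 : 'I_4 := inord 3.
have := @mink_tangent_ge0 _ (x i0 + x i1 + x i2 + x i3 - (4 * C) *: o) o oo.
rewrite !minkL oo !(minkC o) !xo !xx => /(_ ltac:(ring)).
have n01 : i0 != i1 by rewrite -val_eqE /= !inordK.
have n02 : i0 != i2 by rewrite -val_eqE /= !inordK.
have n03 : i0 != i3 by rewrite -val_eqE /= !inordK.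
have n12 : i1 != i2 by rewrite -val_eqE /= !inordK.
have n13 : i1 != i3 by rewrite -val_eqE /= !inordK.
have n23 : i2 != i3 by rewrite -val_eqE /= !inordK.
have := h _ _ n01; have := h _ _ n02; have := h _ _ n03.
have := h _ _ n12; have := h _ _ n13; have := h _ _ n23.
rewrite (minkC (x i1) (x i0)) (minkC (x i2) (x i0)) (minkC (x i3) (x i0)).
rewrite (minkC (x i2) (x i1)) (minkC (x i3) (x i1)) (minkC (x i3) (x i2)).
lra.
Qed.

(** The angle at [o] between a leg and the bisector has cosine at least
    [1 / sqrt 3 > 4 / 7], and [11 / 20 > 1 / 2] is what each of the two legs has
    to gain per unit length of the stem. A stem as short as [rho / 200] makes the
    second order terms negligible against [4 / 7 - 11 / 20]. *)
Lemma star_merge_estimate (rho s q : R) : 0 < rho -> rho <= 2^-1 ->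
  s = rho / 200 -> 0 <= q -> 4 / 3 * sh rho ^+ 2 <= q ^+ 2 ->
  ch s * ch rho - sh s * (q / 2) <= ch (rho - 11 / 20 * s).
Proof.
move=> r0 r1 sE q0 hq; rewrite chB.
set C := ch rho; set S := sh rho.
have Sge : 7 / 8 * rho <= S.
  have := @sh_ge R rho; have : rho * rho <= 2^-1 * rho by rewrite ler_wpM2r//; lra.
  by move=> a /(_ ltac:(lra) ltac:(lra)); rewrite -/S expr2; lra.
have qS : 8 / 7 * S <= q.
  rewrite -(@ler_pXn2r _ 2) ?nnegrE//; last by rewrite mulr_ge0//; lra.
  by apply: le_trans hq; rewrite -/S exprMn; have := sqr_ge0 S; lra.
clear hq; have s0 : 0 < s by lra.
have s1 : s <= 1 / 400 by lra.
have Cle : C <= 5 / 4.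
  have := @ch_small R rho ltac:(lra) ltac:(lra).
  have : rho * rho <= 2^-1 * rho by rewrite ler_wpM2r//; lra.
  rewrite -/C expr2; lra.
have ss : s * s <= 1 / 400 * s by rewrite ler_wpM2r//; lra.
have shs : 1599 / 1600 * s <= sh s.
  have := @sh_ge R s ltac:(lra) ltac:(lra); rewrite expr2; lra.
have chs : ch s <= 1 + s * s.
  by have := @ch_small R s ltac:(lra) ltac:(lra); rewrite expr2.
set t := 11 / 20 * s.
have sht : sh t <= 11 / 20 * s * (701 / 700).
  have := @sh_le R t ltac:(rewrite /t; lra) ltac:(rewrite /t; lra).
  by rewrite /t exprMn; clear -ss s0; lra.
have cht : 1 <= ch t := ch_ge1 _.
have C0 : 0 < C := ch_gt0 _.
have S0 : 0 < S by clear -Sge r0; lra.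
have S40 : 0 <= 4 / 7 * S by clear -S0; lra.
have qS' : 4 / 7 * S <= q / 2 by clear -qS; lra.
have s'0 : 0 <= 1599 / 1600 * s by clear -s0; lra.
have cc : ch s - ch t <= s * s by clear -chs cht; lra.
have h1 : sh s * (q / 2) >= (1599 / 1600 * s) * (4 / 7 * S) by exact: ler_pM.
have h2 : S * sh t <= S * (11 / 20 * s * (701 / 700)) by rewrite ler_pM2l.
have h3 : C * (ch s - ch t) <= 5 / 4 * (s * s).
  by rewrite (@le_trans _ _ (C * (s * s)))// ?ler_pM2l// ler_wpM2r// mulr_ge0// ltW.
have h4 : s * s <= rho * s / 200 by rewrite {1}sE mulrAC.
have h5 : 7 / 8 * rho * s <= S * s by rewrite ler_wpM2r// ltW.
have h6 : 0 < rho * s by rewrite mulr_gt0.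
clear -h6 h1 h2 h3 h4 h5; lra.
Qed.

(** Some two of the legs make an angle with cosine at least [- 1 / 3]. Sliding
    their common end from [o] along the bisector shortens each of them by more
    than half of the distance travelled. *)
Lemma star_split o (x : 'I_4 -> 'cV[R]_4) (rho : R) :
  0 < rho -> rho <= 2^-1 -> hyperboloid o -> (forall i, hyperboloid (x i)) ->
  (forall i, hdist o (x i) = rho) ->
  exists i j o', [/\ i != j, hyperboloid o' &
    hdist o o' + hdist o' (x i) + hdist o' (x j) <= 2 * rho - rho / 2000].
Proof.
move=> r0 r1 ho hx ox; have [oo _] := ho.
have xo i : mink (x i) o = - ch rho by rewrite minkC -(ox i) ch_hdist// opprK.
have [i [j [ij hm]]] := star_close_pair oo (fun i => proj1 (hx i)) xo.
exists i, j; move: hm; set m := mink (x i) (x j); set C := ch rho => hm.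
pose S := sh rho; have CS : C ^+ 2 = 1 + S ^+ 2 := ch2sh2 rho.
pose N := 2 * m - 2 + 4 * C ^+ 2.
have SN : 4 / 3 * S ^+ 2 <= N by rewrite /N; lra.
have S0 : 0 < S by apply: sh_gt0.
have S20 : 0 < S ^+ 2 by rewrite exprn_gt0.
have N0 : 0 < N by lra.
pose q := Num.sqrt N; have q0 : 0 < q by rewrite sqrtr_gt0.
have qq : q ^+ 2 = N by rewrite sqr_sqrtr// ltW.
pose v := x i + x j - (2 * C) *: o.
have vo : mink v o = 0 by rewrite !minkL !xo oo -/C; ring.
have vv : mink v v = N.
  rewrite !minkL (minkC o (x i)) (minkC o (x j)) !xo oo (minkC (x j) (x i)).
  by rewrite (proj1 (hx i)) (proj1 (hx j)) -/m -/C /N; ring.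
have vi : mink v (x i) = N / 2.
  by rewrite !minkL (minkC o) !xo (minkC (x j)) (proj1 (hx i)) -/m -/C /N; field.
have vj : mink v (x j) = N / 2.
  by rewrite !minkL (minkC o) !xo (proj1 (hx j)) -/m -/C /N; field.
clearbody v; pose s := rho / 200; have s0 : 0 < s by clear -r0; rewrite /s; lra.
pose o' := ch s *: o + (sh s / q) *: v.
have o'o : mink o' o = - ch s by rewrite !minkL vo oo; ring.
have o'o' : mink o' o' = -1.
  rewrite !minkL (minkC o v) vo oo vv -qq.
  transitivity (- ch s ^+ 2 + sh s ^+ 2); last by rewrite ch2sh2; ring.
  by field; rewrite gt_eqF.
have ho' : hyperboloid o'.
  by apply: (hyperboloid_sheet ho) => //; rewrite o'o oppr_lt0 ch_gt0.
exists o'; split=> //.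
have -> : hdist o o' = s.
  by apply: hdist_eq => //; [exact: ltW|rewrite minkC o'o opprK].
have key y : hyperboloid y -> mink y o = - C -> mink v y = N / 2 ->
    hdist o' y <= rho - 11 / 20 * s.
  move=> hy yo vy; apply: hdist_le => //; first by rewrite /s; lra.
  have -> : - mink o' y = ch s * C - sh s * (q / 2).
    by rewrite !minkL (minkC o) yo vy -qq; field; rewrite gt_eqF.
  by apply: star_merge_estimate => //; rewrite ?qq// ltW.
have := key _ (hx i) (xo i) vi; have := key _ (hx j) (xo j) vj.
by rewrite /s; lra.
Qed.

End Star.

(** * Continuity in hyperbolic space and homotopies *)

Lemma glue_continuous (R : realType) (T U : topologicalType) (h : T -> R)
    (f g : T -> U) (c : R) :
  continuous h -> continuous f -> continuous g ->
  (forall x, h x = c -> f x = g x) ->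
  continuous (fun x => if h x <= c then f x else g x).
Proof.
move=> ch cf cg fg; apply/continuous_subspace_setT.
have -> : [set: T] = (h @^-1` [set x | x <= c]) `|` (h @^-1` [set x | c <= x]).
  by apply/seteqP; split=> x //= _; case: (leP (h x) c) => [|/ltW]; [left|right].
apply: withinU_continuous.
- by apply: closed_comp => [x _|]; [exact: ch|exact: closed_le].
- by apply: closed_comp => [x _|]; [exact: ch|exact: closed_ge].
- apply: (@subspace_eq_continuous _ _ _ f); last exact: continuous_subspaceT.
  by move=> x; rewrite inE /from_subspace /= => ->.
- apply: (@subspace_eq_continuous _ _ _ g); last exact: continuous_subspaceT.
  move=> x; rewrite inE /from_subspace /= => hx.
  by case: leP => // xh; apply/esym/fg/eqP; rewrite eq_le xh hx.
Qed.

Lemma mx_continuous (T U : topologicalType) m n (f : T -> 'M[U]_(m, n)) :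
  (forall i j, continuous (fun t => f t i j)) -> continuous f.
Proof.
move=> cf t A [P hP sA].
have : \forall s \near t, forall i j, P i j (f s i j).
  apply: filter_forall => i; apply: filter_forall => j; exact: (cf i j).
by apply: filterS => s hs; apply: sA.
Qed.

Lemma comp_continuous (T U V : topologicalType) (f : T -> U) (g : U -> V) :
  continuous f -> continuous g -> continuous (fun x => g (f x)).
Proof. by move=> cf cg x; apply: continuous_comp; [exact: cf|exact: cg]. Qed.

Lemma sum_continuous (R : realType) (T : topologicalType) (I : finType)
    (f : I -> T -> R) :
  (forall i, continuous (f i)) -> continuous (fun t => \sum_i f i t).
Proof.
move=> cf; elim: (index_enum I) => [|i s IH].
  rewrite (_ : (fun t => _) = fun=> 0); first by move=> t; exact: cvg_cst.
  by apply/funext => t; rewrite big_nil.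
rewrite (_ : (fun t => _) = fun t => f i t + \sum_(j <- s) f j t).
  by move=> t; apply: cvgD; [exact: cf|exact: IH].
by apply/funext => t; rewrite big_cons.
Qed.

Section Clamp.
Context (R : realType).

Definition clamp (t : R) : R := Num.max 0 (Num.min t 1).

Lemma clamp_continuous : continuous clamp.
Proof.
move=> t.
have h1 : {for t, continuous ((id : R -> R^o) \min (fun=> 1))}.
  by apply: continuous_min; [exact: cvg_id|exact: cvg_cst].
have h0 : {for t, continuous (fun=> 0 : R^o)} by exact: cvg_cst.
exact: (continuous_max h0 h1).
Qed.

Lemma clamp_itv (t : R) : 0 <= clamp t <= 1.
Proof. by rewrite /clamp le_max ge_max ge_min lexx ler01 lexx orbT. Qed.

Lemma clampE (t : R) : 0 <= t <= 1 -> clamp t = t.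
Proof. by case/andP=> t0 t1; rewrite /clamp (min_idPl t1) (max_idPr t0). Qed.

End Clamp.

Section H3Topology.
Context (R : realType).
Implicit Types (a b x y : H3 R) (T : topologicalType).

Lemma H3P x : hyperboloid (\val x).
Proof. by case: x => v /= /set_mem. Qed.
Hint Resolve H3P : core.

Lemma base_point_subproof : hyperboloid (\col_(i < 4) (i == 0)%:R : 'cV[R]_4).
Proof. by split; [rewrite minkE !mxE /=; ring|rewrite mxE ltr01]. Qed.

Definition base_point : H3 R := SigSub (mem_set base_point_subproof).

(** Total, with a default value off the hyperboloid, so that points can be given
    by formulas in the ambient space. *)
Definition H3_of (v : 'cV[R]_4) : H3 R :=
  match pselect (hyperboloid v) with
  | left h => SigSub (mem_set h)
  | right _ => base_point
  end.

Lemma H3_ofE v : hyperboloid v -> \val (H3_of v) = v.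
Proof. by rewrite /H3_of; case: pselect. Qed.

Lemma H3_inj x y : \val x = \val y -> x = y.
Proof. exact: val_inj. Qed.

Lemma H3_of_val x : H3_of (\val x) = x.
Proof. by apply: H3_inj; rewrite H3_ofE. Qed.

Lemma H3_distE x y : H3_dist x y = hdist (\val x) (\val y).
Proof. by []. Qed.

Lemma H3_val_continuous : continuous (fun x : H3 R => \val x).
Proof. exact: initial_continuous. Qed.

Lemma H3_continuous T (f : T -> H3 R) :
  continuous (fun t => \val (f t)) -> continuous f.
Proof.
move=> cf t U [? /= [[W oW <-]]] /= Wft /filterS; apply; apply: cf.
exact: open_nbhs_nbhs.
Qed.

Lemma H3_of_continuous T (f : T -> 'cV[R]_4) :
  (forall t, hyperboloid (f t)) -> continuous f ->
  continuous (fun t => H3_of (f t)).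
Proof.
move=> hf cf; apply: H3_continuous => t.
rewrite (_ : (fun t => \val (H3_of (f t))) = f); first exact: cf.
by apply/funext => s; rewrite H3_ofE.
Qed.

Lemma mink_continuous T (f g : T -> 'cV[R]_4) : continuous f -> continuous g ->
  continuous (fun t => mink (f t) (g t)).
Proof.
move=> cf cg.
have cfi i : continuous (fun t => f t i 0).
  exact: (comp_continuous cf (@coord_continuous _ _ _ i 0)).
have cgi i : continuous (fun t => g t i 0).
  exact: (comp_continuous cg (@coord_continuous _ _ _ i 0)).
under eq_fun do rewrite minkE.
move=> t; apply: cvgD; first by apply: cvgN; apply: cvgM; [exact: cfi|exact: cgi].
by apply: cvgD; [apply: cvgD|]; apply: cvgM; [exact: cfi|exact: cgi|
  exact: cfi|exact: cgi|exact: cfi|exact: cgi].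
Qed.

Lemma segment_continuous T (f g : T -> H3 R) (s : T -> R) :
  continuous f -> continuous g -> continuous s ->
  (forall t, 0 <= s t <= 1) ->
  continuous (fun t => H3_of (segment (\val (f t)) (\val (g t)) (s t))).
Proof.
move=> cf cg cs s01; apply: H3_of_continuous.
  by move=> t; have /andP[? ?] := s01 t; exact: segmentP.
have cv : continuous (fun t => (1 - s t) *: \val (f t) + s t *: \val (g t)).
  move=> t; apply: cvgD; apply: cvgZ.
  - by apply: cvgB; [exact: cvg_cst|exact: cs].
  - exact: (comp_continuous cf H3_val_continuous).
  - exact: cs.
  - exact: (comp_continuous cg H3_val_continuous).
have cm := mink_continuous cv cv.
move=> t; apply: cvgZ; last exact: cv.
have /andP[s0 s1] := s01 t.
apply: cvgV.
  by rewrite gt_eqF// sqrtr_gt0 (lt_le_trans ltr01)// mink_convex.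
apply: (@continuous_comp _ _ _ (fun t => - mink _ _) Num.sqrt).
  by apply: cvgN; exact: cm.
exact: sqrt_continuous.
Qed.

Lemma sh_continuous : continuous (@sh R).
Proof.
move=> x; apply: cvgM; last exact: cvg_cst.
apply: cvgB; first exact: continuous_expR.
have cN : continuous (fun y : R => - y) by move=> y; apply: cvgN; exact: cvg_id.
exact: (comp_continuous cN (@continuous_expR R)).
Qed.

Definition H3_geodesic a b (t : R) : H3 R := H3_of (geodesic (\val a) (\val b) t).

Lemma H3_geodesic0 a b : H3_geodesic a b 0 = a.
Proof. by rewrite /H3_geodesic geodesic0// H3_of_val. Qed.

Lemma H3_geodesic1 a b : H3_geodesic a b 1 = b.
Proof. by rewrite /H3_geodesic geodesic1// H3_of_val. Qed.

Lemma H3_dist_geodesic a b (s t : R) : s <= t ->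
  H3_dist (H3_geodesic a b s) (H3_geodesic a b t) = (t - s) * H3_dist a b.
Proof.
by move=> st; rewrite !H3_distE !H3_ofE ?hdist_geodesic//; exact: geodesicP.
Qed.

Lemma H3_geodesic_continuous a b : continuous (H3_geodesic a b).
Proof.
apply: H3_of_continuous; first by move=> t; exact: geodesicP.
rewrite /geodesic; have [_|_] := eqVneq; first by move=> t; exact: cvg_cst.
have c1 : continuous (fun t : R => (1 - t) * hdist (\val a) (\val b)).
  move=> t; apply: cvgM; last exact: cvg_cst.
  by apply: cvgB; [exact: cvg_cst|exact: cvg_id].
have c2 : continuous (fun t : R => t * hdist (\val a) (\val b)).
  by move=> t; apply: cvgM; [exact: cvg_id|exact: cvg_cst].
move=> t; apply: cvgZ; first exact: cvg_cst.
apply: cvgD; apply: cvgZ; try exact: cvg_cst.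
- exact: (comp_continuous c1 sh_continuous).
- exact: (comp_continuous c2 sh_continuous).
Qed.

Lemma H3_dist_triangle b a c : H3_dist a c <= H3_dist a b + H3_dist b c.
Proof. by rewrite !H3_distE hdist_triangle. Qed.

Lemma H3_dist_ge0 a b : 0 <= H3_dist a b.
Proof. by rewrite H3_distE hdist_ge0. Qed.

Lemma H3_distC a b : H3_dist a b = H3_dist b a.
Proof. by rewrite !H3_distE hdistC. Qed.

Lemma H3_distxx a : H3_dist a a = 0.
Proof. by rewrite !H3_distE hdistxx. Qed.

Lemma H3_dist_ltE a x (r : R) : 0 < r ->
  (H3_dist a x < r) = (- ch r < mink (\val a) (\val x)).
Proof.
move=> r0; rewrite H3_distE ltrNl -ch_hdist//.
have d0 : 0 <= hdist (\val a) (\val x) by apply: hdist_ge0.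
apply/idP/idP; first exact: ch_lt.
by rewrite !ltNge; apply: contra; apply: ch_le; exact: ltW.
Qed.

Lemma open_H3_ball a (r : R) : 0 < r -> open [set x : H3 R | H3_dist a x < r].
Proof.
move=> r0.
have ca : continuous (fun _ : H3 R => \val a) by exact: cst_continuous.
have cm := mink_continuous ca H3_val_continuous.
suff -> : [set x : H3 R | H3_dist a x < r] =
    (fun x : H3 R => mink (\val a) (\val x)) @^-1` [set y : R | - ch r < y].
  by apply: open_comp => [x _|]; [exact: cm|exact: open_gt].
by apply/funext => x; rewrite /preimage /mkset H3_dist_ltE.
Qed.

Definition act (A : 'M[R]_4) x : H3 R := H3_of (A *m \val x).

Lemma val_act A x : isom_plus A -> \val (act A x) = A *m \val x.
Proof. by move=> iA; apply: H3_ofE; exact: isom_hyperboloid. Qed.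

Lemma act1 x : act 1 x = x.
Proof. by rewrite /act mul1mx H3_of_val. Qed.

Lemma actM A B x : isom_plus A -> isom_plus B -> act (A * B) x = act A (act B x).
Proof. by move=> iA iB; rewrite /act (val_act _ iB) mulmxA. Qed.

Lemma act_dist A x y : isom_plus A -> H3_dist (act A x) (act A y) = H3_dist x y.
Proof. by move=> iA; rewrite !H3_distE !val_act// isom_hdist. Qed.

Lemma act_continuous A : isom_plus A -> continuous (act A).
Proof.
move=> iA; apply: H3_of_continuous; first by move=> x; exact: isom_hyperboloid.
apply: mx_continuous => i j.
have cv k : continuous (fun x : H3 R => \val x k j).
  exact: (comp_continuous H3_val_continuous (@coord_continuous _ _ _ k j)).
have cs : continuous (fun x : H3 R => \sum_k A i k * \val x k j).
  apply: sum_continuous => k x.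
  have c1 : {for x, continuous (fun=> A i k : R)} by exact: cst_continuous.
  exact: (continuousM c1 (cv k x)).
suff -> : (fun x : H3 R => (A *m \val x) i j) =
  (fun x : H3 R => \sum_k A i k * \val x k j) by [].
by apply/funext => x; rewrite mxE.
Qed.

End H3Topology.
#[local] Hint Resolve H3P : core.

(** * Kleinian groups act freely and discontinuously *)

(** Pigeonhole principle for a subdivision into boxes of side [e]. *)
Lemma bounded_matrices_close (R : realType) (A : nat -> 'M[R]_4) (c e : R) :
  0 < e -> (forall n i j, `|A n i j| <= c) ->
  exists m n, (m < n)%N /\ forall i j, `|A m i j - A n i j| < e.
Proof.
move=> e0 Ac.
pose N := Num.truncn (2 * c / e).
pose box n : {ffun 'I_4 * 'I_4 -> 'I_N.+1} :=
  [ffun ij => inord (Num.truncn ((A n ij.1 ij.2 + c) / e))].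
have pos n i j : 0 <= (A n i j + c) / e.
  apply: divr_ge0; last exact: ltW.
  by have := Ac n i j; rewrite ler_norml => /andP[]; lra.
have small n i j : (Num.truncn ((A n i j + c) / e) < N.+1)%N.
  rewrite ltnS; apply: le_truncn; rewrite ler_pM2r ?invr_gt0//.
  by have := Ac n i j; rewrite ler_norml => /andP[]; lra.
pose T := {ffun 'I_4 * 'I_4 -> 'I_N.+1}.
have /injectivePn : ~~ injectiveb (fun n : 'I_(#|{: T}|.+1) => box n).
  apply/negP => /injectiveP/leq_card; by rewrite card_ord ltnn.
move=> [m [n mn bmn]].
have key (p q : nat) : box p = box q -> forall i j, `|A p i j - A q i j| < e.
  move=> bpq i j; move/ffunP/(_ (i, j)): bpq; rewrite !ffunE /=.
  move=> /(congr1 (@nat_of_ord _)); rewrite !inordK// => te.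
  have h1 := truncn_itv (pos p i j); have h2 := truncn_itv (pos q i j).
  rewrite te in h1; move: h1 h2 => /andP[a1 b1] /andP[a2 b2].
  have : `|(A p i j + c) / e - (A q i j + c) / e| < 1.
    rewrite ltr_norml; move: a1 b1 a2 b2; rewrite -natr1.
    by clear; lra.
  rewrite -mulrBl normrM [`|e^-1|]gtr0_norm ?invr_gt0// ltr_pdivrMr// mul1r.
  by congr (`| _ | < _); ring.
have [lt|gt|eq] := ltngtP (m : nat) n.
- by exists m, n; split=> //; exact: key.
- by exists n, m; split=> //; apply: key.
- by move/val_inj: eq mn => ->; rewrite eqxx.
Qed.

Section Discreteness.
Context (R : realType).

Lemma hyperboloid_entry (v : 'cV[R]_4) i : hyperboloid v -> `|v i 0| <= v 0 0.
Proof.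
case=> vv v0; move: vv; rewrite minkE => vv.
have s1 := sqr_ge0 (v (lift 0 0) 0); have s2 := sqr_ge0 (v (lift 0 1) 0).
have s3 := sqr_ge0 (v (lift 0 (lift ord0 (lift ord0 ord0))) 0).
rewrite -(@ler_pXn2r _ 2) ?nnegrE ?(ltW v0)// real_normK ?num_real//.
move: s1 s2 s3; rewrite !expr2.
by case: (ord4_cases i) => ->; lra.
Qed.

(** A basis of the ambient space made of points of hyperbolic space, so that
    the entries of a matrix are controlled by how far these points move. *)
Definition frame (k : 'I_4) : 'cV[R]_4 :=
  if k == 0 then delta_mx 0 0 else (5 / 4) *: delta_mx 0 0 + (3 / 4) *: delta_mx k 0.

Lemma frameP k : hyperboloid (frame k).
Proof.
rewrite /frame; have [_|k0] := eqVneq.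
  by split; [rewrite minkE !mxE /=; ring|rewrite mxE ltr01].
split; last by rewrite !mxE eqxx eq_sym (negbTE k0) /=; lra.
rewrite minkE !mxE ?eqxx.
by case: (ord4_cases k) k0 => -> //= _; lra.
Qed.

Lemma frame_entry (A : 'M[R]_4) i k (c : R) :
  (forall k, `|(A *m frame k) i 0| <= c) -> `|A i k| <= 3 * c.
Proof.
move=> h; have h0 := h 0; have hk := h k.
have colA j : (A *m delta_mx j 0 : 'cV[R]_4) i 0 = A i j.
  by rewrite -colE mxE.
move: h0 hk; rewrite /frame eqxx colA; have [->|k0] := eqVneq.
  by rewrite colA => h0 _; have := normr_ge0 (A i 0); lra.
rewrite mulmxDr -!scalemxAr mxE [X in X + _]mxE [X in _ + X]mxE !colA.
rewrite !ler_norml => /andP[? ?] /andP[? ?]; apply/andP; split; lra.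
Qed.

(** By the triangle inequality an isometry that nearly fixes [x] moves the
    frame a bounded amount. *)
Lemma displacement_entry (x : H3 R) (A : 'M[R]_4) i k : isom_plus A ->
  H3_dist x (act A x) <= 1 ->
  `|A i k| <= 3 * ch (2 * H3_dist x (base_point R) + 1 + arcosh (5 / 4)).
Proof.
move=> iA d1; apply: frame_entry => {}k.
have hp := frameP k; have hAp := isom_hyperboloid iA hp.
apply: le_trans (hyperboloid_entry _ hAp) _.
have b0 : hyperboloid (\val (base_point R)) by [].
have oE (v : 'cV[R]_4) : - mink (\val (base_point R)) v = v 0 0.
  by rewrite minkE !mxE /=; ring.
rewrite -oE -ch_hdist//; apply: ch_le; first exact: hdist_ge0.
have ofk : hdist (\val (base_point R)) (frame k) <= arcosh (5 / 4).
  apply: hdist_le => //; first by apply: arcosh_ge0; lra.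
  rewrite oE arcoshK; last lra.
  rewrite /frame; have [_|k0] := eqVneq; rewrite !mxE ?eqxx /=; first lra.
  by rewrite eq_sym (negbTE k0) /=; lra.
have hx : hyperboloid (\val x) by []. 
have hAx := isom_hyperboloid iA hx.
have := hdist_triangle b0 hx hAp; have := hdist_triangle hx hAx hAp.
have := hdist_triangle hx b0 hp.
rewrite isom_hdist//; move: d1.
rewrite !H3_distE val_act// (hdistC (\val (base_point R)) (\val x)).
lra.
Qed.

Context (Gamma : kleinian R).
Local Notation G := (kleinian_set Gamma).

Lemma kleinian_isolated1 : exists2 e : R, 0 < e &
  forall B, G B -> (forall i j, `|B i j - (1 : 'M[R]_4) i j| < e) -> B = 1.
Proof.
have /nbhs_ballP[e e0 he] := kleinian_discrete (kleinian1 Gamma).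
exists e => // B GB h; apply: he => //; split=> // i j.
by rewrite /ball /= distrC.
Qed.

(** Infinitely many elements moving a point by a bounded amount would
    accumulate, and quotients of nearby elements are close to the identity. *)
Lemma kleinian_finite_displacement (x : H3 R) (A : nat -> 'M[R]_4) :
  (forall n, G (A n)) -> (forall n, H3_dist x (act (A n) x) <= 1) ->
  exists m n, (m < n)%N /\ A m = A n.
Proof.
move=> GA d1; have [e e0 he] := kleinian_isolated1.
pose c := 3 * ch (2 * H3_dist x (base_point R) + 1 + arcosh (5 / 4)).
have c0 : 0 < c by rewrite mulr_gt0// ch_gt0.
have iA n := kleinian_isom (GA n).
have GV n : G (A n)^-1 by apply: kleinianV.
have iV n := kleinian_isom (GV n).
have uA n := isom_plus_unit (iA n).
have Ac n i j : `|A n i j| <= c by apply: displacement_entry.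
have Vc n i j : `|(A n)^-1 i j| <= c.
  apply: displacement_entry => //.
  by rewrite H3_distC -(act_dist _ _ (iA n)) -actM// mulrV// act1.
have e'0 : 0 < e / (5 * c) by rewrite divr_gt0// mulr_gt0.
have [m [n [mn close]]] := bounded_matrices_close e'0 Ac.
exists m, n; split=> //.
suff h1 : (A m)^-1 * A n = 1 by rewrite -[A n]mul1r -(mulrV (uA m)) -mulrA h1 mulr1.
apply: he; first exact: kleinianM.
move=> i j; rewrite -(mulVr (uA m)).
have -> : ((A m)^-1 * A n) i j - ((A m)^-1 * A m) i j =
   \sum_k (A m)^-1 i k * (A n k j - A m k j).
  by rewrite !mxE -sumrB; apply: eq_bigr => k _; rewrite mulrBr.
apply: (@le_lt_trans _ _ (\sum_(k < 4) c * (e / (5 * c)))).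
  apply: le_trans (ler_norm_sum _ _ _) _; apply: ler_sum => k _.
  by rewrite normrM ler_pM// distrC ltW.
rewrite sumr_const card_ord -[X in X < _]mulr_natr.
have -> : c * (e / (5 * c)) * 4 = 4 / 5 * e by field; rewrite gt_eqF.
by lra.
Qed.

(** The powers of an element fixing [x] cannot be pairwise distinct. *)
Lemma kleinian_free (x : H3 R) A : G A -> act A x = x -> A = 1.
Proof.
move=> GA Ax.
have iA := kleinian_isom GA.
have GX n : G (A ^+ n).
  elim: n => [|n IH]; first by rewrite expr0; exact: kleinian1.
  by rewrite exprS; exact: kleinianM.
have fX n : act (A ^+ n) x = x.
  elim: n => [|n IH]; first by rewrite expr0 act1.
  by rewrite exprS actM ?IH//; apply: kleinian_isom.
have [|m [n [mn e]]] := kleinian_finite_displacement (x := x) GX.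
  by move=> n; rewrite fX H3_distxx.
apply: (kleinian_torsion_free (n := n - m) GA); first by rewrite subn_gt0.
have um : A ^+ m \is a GRing.unit by apply: unitrX; exact: isom_plus_unit.
by apply: (mulrI um); rewrite -exprD subnKC ?(ltnW mn)// mulr1 e.
Qed.

(** Otherwise there would be nontrivial elements whose displacements of [x] are
    positive and strictly decreasing. *)
Lemma injectivity_radius (x : H3 R) : exists2 e : R, 0 < e &
  forall A, G A -> H3_dist x (act A x) < e -> A = 1.
Proof.
apply: contrapT => H.
have step (e : R) : exists A, 0 < e -> [/\ G A, H3_dist x (act A x) < e & A <> 1].
  have [e0|] := boolP (0 < e); last by exists 1.
  apply: contrapT => h; apply: H; exists e => // A GA d; apply: contrapT => A1.
  by apply: h; exists A.
have [F HF] := choice step.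
pose eps := fix eps n := if n is n'.+1 then H3_dist x (act (F (eps n')) x) else 1 : R.
have eps0 n : 0 < eps n.
  elim: n => [|n IH]; first exact: ltr01.
  have [GF _ F1] := HF _ IH; rewrite /= lt0r H3_dist_ge0 andbT.
  apply/eqP; rewrite H3_distE => /hdist0_eq h; apply: F1.
  by apply: (kleinian_free (x := x) GF); apply/esym/H3_inj/h.
have epsS n : eps n.+1 < eps n by have [] := HF _ (eps0 n).
have mono m n : (m < n)%N -> eps n < eps m.
  elim: n => // n IH; rewrite ltnS leq_eqVlt => /predU1P[->//|/IH h].
  exact: lt_trans (epsS n) h.
have eps1 n : eps n <= 1.
  by elim: n => // n IH; rewrite (le_trans _ IH)// ltW.
have [| |m [n [mn e]]] := @kleinian_finite_displacement x (fun n => F (eps n)).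
- by move=> n; have [] := HF _ (eps0 n).
- by move=> n; exact: (eps1 n.+1).
have : eps n.+1 < eps m.+1 by apply: mono.
by rewrite /= e ltxx.
Qed.

End Discreteness.

(** * Path lifting *)

Section Lifting.
Context (R : realType) (Gamma : kleinian R).
Local Notation G := (kleinian_set Gamma).
Local Notation M := (manifold Gamma).
Local Notation pr := (@manifold_proj R Gamma).
Implicit Types (p : R -> M) (a b x y : H3 R).

Lemma pr_eq x y : pr x = pr y <-> exists2 A, G A & y = act A x.
Proof.
rewrite /manifold_proj; split.
  move=> /eqmodP /asboolP[A GA e]; exists A => //.
  by apply: H3_inj; rewrite val_act//; exact: (kleinian_isom GA).
case=> A GA ->; apply/eqmodP/asboolP; exists A => //.
by rewrite val_act//; exact: (kleinian_isom GA).
Qed.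

Lemma pr_act A x : G A -> pr (act A x) = pr x.
Proof. by move=> GA; apply/esym/pr_eq; exists A. Qed.

Lemma pr_surj (m : M) : exists x, pr x = m.
Proof. by exists (generic_quotient.repr m); exact: reprK. Qed.

Lemma pr_continuous : continuous pr.
Proof. exact: pi_continuous. Qed.

(** The saturation of an open set is the union of its translates. *)
Lemma pr_open (U : set (H3 R)) : open U -> open (pr @` U).
Proof.
move=> oU; rewrite /open /= /quotient_open.
rewrite (_ : _ @^-1` _ = \bigcup_(A in G) (act A @^-1` U)).
  apply: bigcup_open => A GA; apply: open_comp => // x _.
  exact: (act_continuous (kleinian_isom GA)).
apply/seteqP; split=> x /=.
  by case=> y Uy /esym /pr_eq[A GA yE]; exists A => //=; rewrite -yE.
case=> A GA /= UAx; exists (act A x) => //; exact: pr_act.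
Qed.

Lemma manifold_dist_le x y : manifold_dist (pr x) (pr y) <= H3_dist x y.
Proof.
apply: ge_inf; last by exists (x, y).
by exists 0 => _ [[a b] _ <-]; exact: H3_dist_ge0.
Qed.

Lemma manifold_dist_ge x y (e : R) :
  (forall A, G A -> e <= H3_dist x (act A y)) ->
  e <= manifold_dist (pr x) (pr y).
Proof.
move=> h; apply: lb_le_inf; first by exists (H3_dist x y); exists (x, y).
move=> _ [[a b] /= [/esym/pr_eq[A GA ->] /esym/pr_eq[B GB ->]] <-].
have iA := kleinian_isom GA; have GV := kleinianV GA; have iV := kleinian_isom GV.
have uA := isom_plus_unit iA; have iB := kleinian_isom GB.
rewrite -(act_dist _ _ iV) -!actM//.
  rewrite mulVr// act1; apply: h; exact: kleinianM.
Qed.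

(** The sums in the definition of [path_length], in a form suited to induction on
    the partition. *)
Fixpoint polygonal p (u : R) (l : seq R) : R :=
  if l is v :: l' then manifold_dist (p u) (p v) + polygonal p v l' else 0.

Lemma polygonalE p u l : polygonal p u l =
  \sum_(i < size l) manifold_dist (p (nth 0 (u :: l) i)) (p (nth 0 l i)).
Proof.
elim: l u => [|v l IH] u; first by rewrite big_ord0.
by rewrite big_ord_recl /= IH; congr (_ + _); apply: eq_bigr.
Qed.

Lemma polygonal_cat p u v l1 l2 : itv_partition u v l1 ->
  polygonal p u (l1 ++ l2) = polygonal p u l1 + polygonal p v l2.
Proof.
elim: l1 u => [|w l1 IH] u /=; first by move=> /itv_partition_nil ->; rewrite add0r.
by move=> /itv_partition_cons /IH ->; rewrite addrA.
Qed.

(** The comparison of lengths is part of the property because it is patched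
    together from short intervals in the same way as the lift itself. *)
Definition lift_on p (u v : R) : Prop := forall a, pr a = p u ->
  exists q : R -> H3 R, [/\ continuous q, q u = a,
    forall s, u <= s <= v -> pr (q s) = p s &
    exists2 l, itv_partition u v l & H3_dist (q u) (q v) <= polygonal p u l].

Lemma lift_on_cat p (u v w : R) : u <= v -> v <= w ->
  lift_on p u v -> lift_on p v w -> lift_on p u w.
Proof.
move=> uv vw h1 h2 a pa; have [q1 [c1 q1u q1p [l1 hl1 d1]]] := h1 a pa.
have [|q2 [c2 q2v q2p [l2 hl2 d2]]] := h2 (q1 v).
  by apply: q1p; rewrite uv lexx.
exists (fun s => if s <= v then q1 s else q2 s); split.
- apply: (@glue_continuous _ _ _ id) => //; first by move=> ?; exact: cvg_id.
  by move=> s ->; rewrite q2v.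
- by rewrite uv.
- move=> s /andP[us sw]; case: leP => sv; first by apply: q1p; rewrite us sv.
  by apply: q2p; rewrite sw (ltW sv).
- exists (l1 ++ l2); first exact: itv_partition_cat hl1 hl2.
  rewrite uv (polygonal_cat _ _ hl1).
  have -> : (if w <= v then q1 w else q2 w) = q2 w.
    by case: leP => // wv; have -> : w = v by apply/eqP; rewrite eq_le wv.
  apply: le_trans (H3_dist_triangle (q1 v) _ _) _.
  by apply: lerD => //; rewrite -q2v.
Qed.

(** A set-theoretic section with values in [U] is the inverse of an open
    injection. *)
Lemma section_continuous (U : set (H3 R)) (q : R -> H3 R) :
  open U -> {in U &, forall x y, pr x = pr y -> x = y} ->
  (forall s, U (q s)) -> continuous (fun s => pr (q s)) -> continuous q.
Proof.
move=> oU injU Uq cq s W /=; rewrite nbhsE => -[W0 [oW0 W0q] W0W].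
have hN : nbhs (pr (q s)) (pr @` (W0 `&` U)).
  apply: open_nbhs_nbhs; split; first by apply: pr_open; exact: openI.
  by exists (q s) => //; split.
apply: (@filterS _ (nbhs s) _ (fun s' => (pr @` (W0 `&` U)) (pr (q s')))
  (q @^-1` W)); last exact: (cq s _ hN).
move=> s' /= [y [W0y Uy] yE]; apply: W0W.
by rewrite -(injU y (q s')) ?inE.
Qed.

(** The covering projection is isometric on a small ball, over whose image, an open
    set, the path can be lifted into the ball. *)
Lemma lift_on_local p (t : R) : continuous p ->
  exists2 e : R, 0 < e &
    forall u v, t - e < u -> u <= v -> v < t + e -> lift_on p u v.
Proof.
move=> cp; have [x px] := pr_surj (p t); have [e e0 inj] := injectivity_radius Gamma x.
pose U := [set y : H3 R | H3_dist x y < e / 8].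
have e80 : 0 < e / 8 by rewrite divr_gt0.
have oU : open U by apply: open_H3_ball.
have Ux : U x by rewrite /U /= H3_distxx.
(* distances in [U] are not shortened by deck transformations *)
have iso y z A : U y -> U z -> G A -> H3_dist y z <= H3_dist y (act A z).
  rewrite /U /= => Uy Uz GA; have iA := kleinian_isom GA.
  have t1 := H3_dist_triangle x y z; rewrite (H3_distC y x) in t1.
  have [->|A1] := eqVneq A 1; first by rewrite act1.
  have : e <= H3_dist x (act A x).
    by rewrite leNgt; apply/negP => /(inj _ GA) /eqP; rewrite (negbTE A1).
  have := H3_dist_triangle y x (act A x).
  have := H3_dist_triangle (act A z) y (act A x).
  rewrite (H3_distC (act A z) (act A x)) act_dist//; lra.
have injU : {in U &, forall y z, pr y = pr z -> y = z}.
  move=> y z; rewrite !inE => Uy Uz /pr_eq[A GA zE].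
  have h := iso _ _ _ Uz Uy GA; rewrite -zE H3_distxx in h.
  apply/esym/H3_inj/hdist0_eq => //; apply/eqP; rewrite eq_le -H3_distE h /=.
  by rewrite H3_dist_ge0.
have hN : nbhs (p t) (pr @` U).
  by apply: open_nbhs_nbhs; split; [exact: pr_open|exists x].
have /nbhs_ballP[d /= d0 hd] := cp t _ hN; exists d => // u v tu uv vt a pa.
have inU s : u <= s <= v -> exists y, U y /\ pr y = p s.
  move=> /andP[us sv]; have [|y Uy yE] := hd s; last by exists y.
  by rewrite /ball /= ltr_norml; apply/andP; split; lra.
pose c s := Num.max u (Num.min s v).
have cuv s : u <= c s <= v.
  by rewrite /c le_max lexx /= ge_max uv /= ge_min lexx orbT.
have cE s : u <= s <= v -> c s = s.
  by move=> /andP[us sv]; rewrite /c (min_idPl sv) (max_idPr us).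
have cc : continuous c.
  move=> s.
  have h1 : {for s, continuous ((id : R -> R^o) \min (fun=> v))}.
    by apply: continuous_min; [exact: cvg_id|exact: cvg_cst].
  have h0 : {for s, continuous (fun=> u : R^o)} by exact: cvg_cst.
  exact: (continuous_max h0 h1).
have [q Hq] := choice (fun s => inU (c s) (cuv s)).
have cq : continuous q.
  apply: (section_continuous oU injU); first by move=> s; case: (Hq s).
  rewrite (_ : (fun s => pr (q s)) = fun s => p (c s)).
    exact: (comp_continuous cc cp).
  by apply/funext => s; case: (Hq s).
have qE s : u <= s <= v -> pr (q s) = p s by move=> /cE {2}<-; case: (Hq s).
have uuv : u <= u <= v by rewrite lexx.
have vuv : u <= v <= v by rewrite uv lexx.
have [A GA aE] : exists2 A, G A & a = act A (q u) by apply/pr_eq; rewrite qE.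
have iA := kleinian_isom GA.
exists (fun s => act A (q s)); split.
- exact: (comp_continuous cq (act_continuous iA)).
- by rewrite aE.
- by move=> s hs; rewrite pr_act// qE.
- have [uv'|->] : u < v \/ u = v.
    by move: uv; rewrite le_eqVlt => /predU1P[->|->]; [right|left].
    exists [:: v]; first exact: itv_partition1.
    rewrite /= addr0 act_dist// -!qE//; apply: manifold_dist_ge => B GB.
    by apply: iso => //; [case: (Hq u)|case: (Hq v)].
  by exists [::]; [split|rewrite /= H3_distxx].
Qed.

(** The supremum of the times up to which [p] can be lifted is attained and is
    not less than 1. *)
Lemma lift_on_unit p : continuous p -> lift_on p 0 1.
Proof.
move=> cp.
pose S := [set t : R | 0 <= t <= 1 /\ lift_on p 0 t].
have S0 : S 0.
  split; first by rewrite lexx ler01.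
  by have [e e0] := lift_on_local 0 cp; apply; lra.
have supS : has_sup S by split; [exists 0|exists 1 => t [/andP[]]].
pose s := sup S.
have s0 : 0 <= s by apply: ub_le_sup => //; case: supS.
have s1 : s <= 1 by apply: ge_sup; [exists 0|move=> t [/andP[]]].
have [e e0 loc] := lift_on_local s cp.
have [t [t01 ht] st] : exists2 t, S t & s - e < t by apply: sup_adherent.
have ts : t <= s by apply: ub_le_sup; [case: supS|split].
pose w := Num.min (s + e / 2) 1.
have w1 : w <= 1 by rewrite /w ge_min lexx orbT.
have ws : w <= s + e / 2 by rewrite /w ge_min lexx.
have tw : t <= w by rewrite /w le_min; apply/andP; split; lra.
have t0 : 0 <= t by case/andP: t01.
have Sw : S w.
  split; first by rewrite w1 andbT; lra.
  by apply: lift_on_cat ht _ => //; apply: loc => //; lra.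
have : w <= s by apply: ub_le_sup; first by case: supS.
have [e1|e1] := leP (s + e / 2) 1; first by rewrite /w (min_idPl e1); lra.
by move=> _; case: Sw; rewrite /w (min_idPr (ltW e1)).
Qed.

(** Only the ends of the lift are recorded, since they determine the homotopy
    class ([lifts_homotopic]). *)
Definition lifts p a b : Prop := exists q : R -> H3 R,
  [/\ continuous q, q 0 = a, q 1 = b & forall t, 0 <= t <= 1 -> pr (q t) = p t].

(** The pieces of a sufficiently fine partition are no shorter than the distances
    between the ends of their lifts. *)
Lemma path_lifting p m n a : is_path m n p -> pr a = m ->
  exists b, lifts p a b /\ ((H3_dist a b)%:E <= path_length p)%E.
Proof.
case=> cp p0 p1 pa.
pose p' t := p (clamp t).
have cp' : continuous p'.
  move=> t W /= /(cp (clamp t)); rewrite /nbhs /= => h.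
  have ct : `[0, 1]%classic (clamp t) by rewrite /= in_itv /= clamp_itv.
  move: h; rewrite -nbhs_subspace_in// => h.
  apply: (@filterS _ (nbhs t) _ _ (p' @^-1` W) _ (@clamp_continuous R t _ h)).
  by move=> s; apply; rewrite /= in_itv /= clamp_itv.
have [|q [cq q0 qp [l hl dl]]] := lift_on_unit cp' (a := a).
  by rewrite /p' clampE ?lexx ?ler01// p0.
exists (q 1); split.
  exists q; split=> // t t01; by rewrite qp// /p' clampE.
have polyE u k : 0 <= u -> itv_partition u 1 k -> polygonal p' u k = polygonal p u k.
  elim: k u => [//|v k IH] u u0 huk /=.
  have hk := itv_partition_cons huk; have v1 := itv_partition_le hk.
  have u1 := itv_partition_le huk.
  have uv : u < v by case: huk => /= /andP[].
  have v0 : 0 <= v by rewrite (le_trans u0)// ltW.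
  by rewrite IH// /p' !clampE// ?u0 ?v0.
apply: (@le_trans _ _ (polygonal p 0 l)%:E).
  by rewrite lee_fin -polyE// -q0.
by apply: ereal_sup_ubound; exists l => //; rewrite polygonalE.
Qed.

End Lifting.

(** * Homotopies of paths *)

Lemma pair_continuous (T U V : topologicalType) (f : T -> U) (g : T -> V) :
  continuous f -> continuous g -> continuous (fun x => (f x, g x)).
Proof. by move=> cf cg x; apply: cvg_pair; [exact: cf|exact: cg]. Qed.

Lemma fst_cts (T U : topologicalType) : continuous (fun z : T * U => z.1).
Proof. by move=> z; exact: cvg_fst. Qed.

Lemma snd_cts (T U : topologicalType) : continuous (fun z : T * U => z.2).
Proof. by move=> z; exact: cvg_snd. Qed.

Section PathHomotopy.
Context (R : realType) (T : topologicalType).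
Implicit Types p q c : R -> T.

Lemma clamp0 : clamp (0 : R) = 0.
Proof. by rewrite clampE ?lexx ?ler01. Qed.

Lemma clamp1 : clamp (1 : R) = 1.
Proof. by rewrite clampE ?lexx ?ler01. Qed.

(** Precomposition with the retraction on the unit square makes a homotopy
    continuous on the whole plane. *)
Lemma homotopy_global p q : path_homotopic p q ->
  exists H : R * R -> T, [/\ continuous H,
    forall t, H (0, t) = p (clamp t) /\ H (1, t) = q (clamp t) &
    forall s, H (s, 0) = p 0 /\ H (s, 1) = p 1].
Proof.
case=> H [cH H01 Hs].
exists (fun z => H (clamp z.1, clamp z.2)); split.
- pose r (z : R * R) := (clamp z.1, clamp z.2).
  have cr : continuous r.
    apply: pair_continuous.
      apply: (comp_continuous (g := @clamp R)); [exact: fst_cts|exact: clamp_continuous].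
    apply: (comp_continuous (g := @clamp R)); [exact: snd_cts|exact: clamp_continuous].
  have r01 z : (`[0, 1]%classic `*` `[0, 1]%classic) (r z).
    by split; rewrite /= in_itv /= clamp_itv.
  move=> z W /= /(cH (r z)); rewrite /nbhs /= => h.
  move: h; rewrite -nbhs_subspace_in// => h.
  apply: (@filterS _ (nbhs z) _ _ ((H \o r) @^-1` W) _ (cr z _ h)).
  by move=> s; apply; exact: r01.
- by move=> t; rewrite /= clamp0 clamp1; apply: H01; rewrite in_itv /= clamp_itv.
- by move=> s; rewrite /= clamp0 clamp1; apply: Hs; rewrite in_itv /= clamp_itv.
Qed.

Lemma homotopic_of_global p q (H : R * R -> T) : continuous H ->
  (forall t, 0 <= t <= 1 -> H (0, t) = p t /\ H (1, t) = q t) ->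
  (forall s, 0 <= s <= 1 -> H (s, 0) = p 0 /\ H (s, 1) = p 1) ->
  path_homotopic p q.
Proof.
move=> cH H01 Hs; exists H; split.
- exact: continuous_subspaceT.
- by move=> t; rewrite in_itv; exact: H01.
- by move=> s; rewrite in_itv; exact: Hs.
Qed.

Lemma dbl_continuous (U : topologicalType) (f : U -> R) : continuous f ->
  continuous (fun x => 2 * f x).
Proof.
move=> cf x; have c1 : {for x, continuous (fun=> 2 : R)} by exact: cst_continuous.
exact: (continuousM c1 (cf x)).
Qed.

Lemma dbl1_continuous (U : topologicalType) (f : U -> R) : continuous f ->
  continuous (fun x => 2 * f x - 1).
Proof.
move=> cf x; apply: cvgB; [exact: dbl_continuous|exact: cvg_cst].
Qed.

Lemma path_homotopic_trans q p c :
  path_homotopic p q -> path_homotopic q c -> path_homotopic p c.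
Proof.
move=> /homotopy_global[H1 [c1 t1 s1]] /homotopy_global[H2 [c2 t2 s2]].
have p0 : p 0 = q 0.
  by have [<- _] := s1 1; have [_ ->] := t1 0; rewrite clamp0.
have p1 : p 1 = q 1.
  by have [_ <-] := s1 1; have [_ ->] := t1 1; rewrite clamp1.
apply: (@homotopic_of_global _ _
  (fun z => if z.1 <= 2^-1 then H1 (2 * z.1, z.2) else H2 (2 * z.1 - 1, z.2))).
- apply: glue_continuous.
  + exact: fst_cts.
  + apply: (comp_continuous (g := H1)) => //.
    by apply: pair_continuous; [apply: dbl_continuous; exact: fst_cts|exact: snd_cts].
  + apply: (comp_continuous (g := H2)) => //.
    by apply: pair_continuous; [apply: dbl1_continuous; exact: fst_cts|exact: snd_cts].
  + move=> z ->; rewrite mulfV// subrr.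
    by have [_ ->] := t1 z.2; have [-> _] := t2 z.2.
- move=> t t01; rewrite /= invr_ge0 ler0n mulr0 mulr1.
  rewrite leNgt invf_lt1 ?ltr1n//=.
  have -> : (2 - 1 : R) = 1 by lra.
  by have [-> _] := t1 t; have [_ ->] := t2 t; rewrite clampE.
- move=> s s01 /=; case: ifP => _; first exact: s1.
  by rewrite p0 p1; exact: s2.
Qed.

Lemma path_concat_homotopic p q p' q' : p 1 = q 0 ->
  path_homotopic p p' -> path_homotopic q q' ->
  path_homotopic (path_concat p q) (path_concat p' q').
Proof.
move=> pq /homotopy_global[H1 [c1 t1 s1]] /homotopy_global[H2 [c2 t2 s2]].
apply: (@homotopic_of_global _ _
  (fun z => if z.2 <= 2^-1 then H1 (z.1, 2 * z.2) else H2 (z.1, 2 * z.2 - 1))).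
- apply: glue_continuous.
  + exact: snd_cts.
  + apply: (comp_continuous (g := H1)) => //.
    by apply: pair_continuous; [exact: fst_cts|apply: dbl_continuous; exact: snd_cts].
  + apply: (comp_continuous (g := H2)) => //.
    by apply: pair_continuous; [exact: fst_cts|apply: dbl1_continuous; exact: snd_cts].
  + move=> z ->; rewrite mulfV// subrr.
    by have [_ ->] := s1 z.1; have [-> _] := s2 z.1.
- move=> t /andP[t0 t1']; rewrite /path_concat /=; case: leP => th.
    by have [-> ->] := t1 (2 * t); rewrite clampE//; apply/andP; split; lra.
  by have [-> ->] := t2 (2 * t - 1); rewrite clampE//; apply/andP; split; lra.
- move=> s _; rewrite /path_concat /= invr_ge0 ler0n mulr0 mulr1.
  rewrite leNgt invf_lt1 ?ltr1n//=.
  have -> : (2 - 1 : R) = 1 by lra.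
  by have [-> _] := s1 s; have [_ ->] := s2 s.
Qed.

End PathHomotopy.

Section LiftedPaths.
Context (R : realType) (Gamma : kleinian R).
Local Notation G := (kleinian_set Gamma).
Local Notation M := (manifold Gamma).
Local Notation pr := (@manifold_proj R Gamma).
Local Notation lifts := (@lifts R Gamma).
Implicit Types (p q : R -> M) (a b c : H3 R).

Lemma lifts_is_path p a b : lifts p a b -> is_path (pr a) (pr b) p.
Proof.
case=> q [cq <- <- qp]; split; rewrite ?qp ?lexx ?ler01//.
apply: (@subspace_eq_continuous _ _ _ (fun t => pr (q t))).
  by move=> t; rewrite inE /= in_itv; exact: qp.
apply: continuous_subspaceT; exact: (comp_continuous cq (@pr_continuous _ _)).
Qed.

Lemma lifts_act p a b A : G A -> lifts p a b -> lifts p (act A a) (act A b).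
Proof.
move=> GA [q [cq <- <- qp]]; exists (fun t => act A (q t)); split=> //.
  exact: (comp_continuous cq (act_continuous (kleinian_isom GA))).
by move=> t t01; rewrite pr_act// qp.
Qed.

Lemma lifts_cst a : lifts (cst (pr a)) a a.
Proof. by exists (cst a); split=> //; exact: cst_continuous. Qed.

Lemma lifts_rev p a b : lifts p a b -> lifts (path_rev p) b a.
Proof.
case=> q [cq <- <- qp]; exists (fun t => q (1 - t)); split.
- apply: (comp_continuous (f := fun t : R => 1 - t)) => //.
  by move=> t; apply: cvgB; [exact: cvg_cst|exact: cvg_id].
- by rewrite subr0.
- by rewrite subrr.
- by move=> t /andP[t0 t1]; rewrite qp//; apply/andP; split; lra.
Qed.

Lemma lifts_concat b p q a c : lifts p a b -> lifts q b c ->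
  lifts (path_concat p q) a c.
Proof.
case=> [p' [cp' <- pb pE]] [q' [cq' qb <- qE]].
exists (fun t => if t <= 2^-1 then p' (2 * t) else q' (2 * t - 1)); split.
- apply: (@glue_continuous _ _ _ id).
  + by move=> ?; exact: cvg_id.
  + by apply: (comp_continuous (g := p')) => //; apply: dbl_continuous => ?; exact: cvg_id.
  + by apply: (comp_continuous (g := q')) => //; apply: dbl1_continuous => ?; exact: cvg_id.
  + by move=> t ->; rewrite mulfV// subrr pb qb.
- by rewrite invr_ge0 ler0n mulr0.
- rewrite leNgt invf_lt1 ?ltr1n//= mulr1; congr q'; lra.
- move=> t /andP[t0 t1]; rewrite /path_concat; case: leP => th.
    by rewrite pE//; apply/andP; split; lra.
  by rewrite qE//; apply/andP; split; lra.
Qed.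

(** Hyperbolic space is contractible along segments, so only the endpoints of
    a lift matter for the homotopy class. *)
Lemma lifts_homotopic p q a b : lifts p a b -> lifts q a b -> path_homotopic p q.
Proof.
case=> [p' [cp' p0 p1 pE]] [q' [cq' q0 q1 qE]].
apply: (@homotopic_of_global _ _ _ _ (fun z => pr (H3_of
  (segment (\val (p' z.2)) (\val (q' z.2)) (clamp z.1))))).
- apply: (comp_continuous (g := pr)); last exact: pr_continuous.
  apply: (@segment_continuous _ _ (fun z : R * R => p' z.2) (fun z => q' z.2)).
  + by apply: (comp_continuous (g := p')) => //; exact: snd_cts.
  + by apply: (comp_continuous (g := q')) => //; exact: snd_cts.
  + by apply: (comp_continuous (g := @clamp R)); [exact: fst_cts|exact: clamp_continuous].
  + by move=> z; exact: clamp_itv.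
- move=> t t01; rewrite [(0, t).1]/= [(1, t).1]/= [(0, t).2]/= [(1, t).2]/=.
  rewrite clamp0 clamp1 segment0// segment1// !H3_of_val.
  by rewrite pE// qE.
- move=> s s01; rewrite [(s, 0).1]/= [(s, 1).1]/= [(s, 0).2]/= [(s, 1).2]/=.
  rewrite p0 q0 p1 q1 !segment_same// !H3_of_val -p0 -p1.
  by rewrite !pE ?lexx ?ler01.
Qed.

Definition geodesic_path a b : R -> M := fun t => pr (H3_geodesic a b t).

Lemma lifts_geodesic a b : lifts (geodesic_path a b) a b.
Proof.
exists (H3_geodesic a b); split=> //; first exact: H3_geodesic_continuous.
  exact: H3_geodesic0.
exact: H3_geodesic1.
Qed.

Lemma geodesic_path_length a b :
  (path_length (geodesic_path a b) <= (H3_dist a b)%:E)%E.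
Proof.
apply: ge_ereal_sup => _ [l hl <-]; rewrite lee_fin -polygonalE.
suff h (u v : R) k : itv_partition u v k ->
    polygonal (geodesic_path a b) u k <= (v - u) * H3_dist a b.
  by have := h _ _ _ hl; rewrite subr0 mul1r.
elim: k u => [|w k IH] u /=.
  by move=> /itv_partition_nil ->; rewrite subrr mul0r.
move=> huk; have hk := itv_partition_cons huk.
have uw : u < w by case: huk => /= /andP[].
have := IH _ hk; have := manifold_dist_le Gamma (H3_geodesic a b u) (H3_geodesic a b w).
rewrite H3_dist_geodesic; last exact: ltW.
rewrite /geodesic_path; lra.
Qed.

End LiftedPaths.

(** * Words of darts *)

Section Words.
Context (X : graph).
Implicit Types (u v : vertex X) (d : dart X) (w : seq (dart X)).

Local Notation "w ~~ w'" := (@walk_homotopic X w w') (at level 70).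

Lemma dart_flipK d : dart_flip (dart_flip d) = d.
Proof. by case: d => e b; rewrite /dart_flip /= negbK. Qed.

Lemma dart_src_flip d : dart_src (dart_flip d) = dart_tgt d.
Proof. by case: d => e []. Qed.

Lemma dart_tgt_flip d : dart_tgt (dart_flip d) = dart_src d.
Proof. by case: d => e []. Qed.

Lemma walk_rev_cons d w : walk_rev (d :: w) = walk_rev w ++ [:: dart_flip d].
Proof. by rewrite /walk_rev /= rev_cons cats1. Qed.

Lemma walk_rev_cat w1 w2 : walk_rev (w1 ++ w2) = walk_rev w2 ++ walk_rev w1.
Proof. by rewrite /walk_rev map_cat rev_cat. Qed.

Lemma walk_revK w : walk_rev (walk_rev w) = w.
Proof.
rewrite /walk_rev map_rev revK -map_comp (eq_map (g := id)) ?map_id// => d.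
exact: dart_flipK.
Qed.

Lemma is_walk_cat u v t w1 w2 :
  is_walk u v w1 -> is_walk v t w2 -> is_walk u t (w1 ++ w2).
Proof.
elim: w1 u => [u /= ->//|d w1 IH u /= [<- h] h2]; split=> //; exact: IH.
Qed.

Lemma is_walk_catE u t w1 w2 : is_walk u t (w1 ++ w2) ->
  exists v, is_walk u v w1 /\ is_walk v t w2.
Proof.
elim: w1 u => [u h|d w1 IH u /= [<- /IH[v [h1 h2]]]]; first by exists u.
by exists v.
Qed.

Lemma is_walk_rev u v w : is_walk u v w -> is_walk v u (walk_rev w).
Proof.
elim: w u => [u /= ->//|d w IH u /= [<- /IH h]].
rewrite walk_rev_cons; apply: is_walk_cat h _.
by split; rewrite ?dart_src_flip//= dart_tgt_flip.
Qed.

Lemma walk_homotopic_refl w : w ~~ w. Proof. exact: rst_refl. Qed.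
Lemma walk_homotopic_trans w2 w1 w3 : w1 ~~ w2 -> w2 ~~ w3 -> w1 ~~ w3.
Proof. exact: rst_trans. Qed.

Lemma walk_homotopic_cat w1 w1' w2 w2' : w1 ~~ w1' -> w2 ~~ w2' -> w1 ++ w2 ~~ w1' ++ w2'.
Proof.
move=> h1 h2; apply: (@walk_homotopic_trans (w1' ++ w2)).
  elim: h1 => [a b [c1 [c2 [d [-> ->]]]]|a|a b _|a b c _ ab _ bc].
  - by apply: rst_step; exists c1, (c2 ++ w2), d; rewrite -!catA.
  - exact: rst_refl.
  - exact: rst_sym.
  - exact: rst_trans ab bc.
elim: h2 => [a b [c1 [c2 [d [-> ->]]]]|a|a b _|a b c _ ab _ bc].
- by apply: rst_step; exists (w1' ++ c1), c2, d; rewrite -!catA.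
- exact: rst_refl.
- exact: rst_sym.
- exact: rst_trans ab bc.
Qed.

Lemma walk_homotopic_revr w : w ++ walk_rev w ~~ [::].
Proof.
elim: w => [|d w IH]; first exact: rst_refl.
rewrite walk_rev_cons -cat1s -!catA (catA w).
apply: (@walk_homotopic_trans ([:: d] ++ [::] ++ [:: dart_flip d])).
  apply: walk_homotopic_cat (walk_homotopic_refl _) _.
  by apply: walk_homotopic_cat => //; exact: walk_homotopic_refl.
by apply: rst_step; exists [::], [::], d.
Qed.

Lemma walk_homotopic_revl w : walk_rev w ++ w ~~ [::].
Proof. by rewrite -{2}(walk_revK w); exact: walk_homotopic_revr. Qed.

Lemma walk_homotopic_conj s d r :
  walk_rev s ++ (s ++ d :: walk_rev r) ++ r ~~ [:: d].
Proof.
rewrite -[d :: walk_rev r]cat1s -!catA catA.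
apply: (@walk_homotopic_trans ([::] ++ [:: d] ++ [::])); last exact: walk_homotopic_refl.
apply: walk_homotopic_cat; first exact: walk_homotopic_revl.
by apply: walk_homotopic_cat; [exact: walk_homotopic_refl|exact: walk_homotopic_revl].
Qed.

Lemma walk_homotopic_rev w w' : w ~~ w' -> walk_rev w ~~ walk_rev w'.
Proof.
elim=> [a b [c1 [c2 [d [-> ->]]]]|a|a b _|a b c _ ab _ bc].
- rewrite !walk_rev_cat !walk_rev_cons -!catA dart_flipK.
  by apply: rst_step; exists (walk_rev c2), (walk_rev c1), d.
- exact: rst_refl.
- exact: rst_sym.
- exact: rst_trans ab bc.
Qed.

End Words.

(** Maps of graphs sending darts to walks, and the induced map of edge-path
    groupoids. *)
Section Substitution.
Context (X Y : graph) (phi : dart X -> seq (dart Y)).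
Hypothesis phi_flip : forall d, phi (dart_flip d) = walk_rev (phi d).

Definition subst_walk (w : seq (dart X)) : seq (dart Y) := flatten (map phi w).

Lemma subst_walk_cat w1 w2 :
  subst_walk (w1 ++ w2) = subst_walk w1 ++ subst_walk w2.
Proof. by rewrite /subst_walk map_cat flatten_cat. Qed.

Lemma subst_walk_rev w : subst_walk (walk_rev w) = walk_rev (subst_walk w).
Proof.
elim: w => [//|d w IH]; rewrite walk_rev_cons subst_walk_cat IH.
by rewrite /subst_walk /= cats0 walk_rev_cat phi_flip.
Qed.

Lemma subst_walk_homotopic w w' : walk_homotopic w w' ->
  walk_homotopic (subst_walk w) (subst_walk w').
Proof.
elim=> [a b [c1 [c2 [d [-> ->]]]]|a|a b _|a b c _ ab _ bc].
- rewrite !subst_walk_cat; apply: walk_homotopic_cat; first exact: walk_homotopic_refl.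
  rewrite /subst_walk /= phi_flip catA -[X in walk_homotopic _ X]cat0s.
  by apply: walk_homotopic_cat; [exact: walk_homotopic_revr|exact: walk_homotopic_refl].
- exact: rst_refl.
- exact: rst_sym.
- exact: rst_trans ab bc.
Qed.

Lemma subst_walk_word n (h : 'I_n -> seq (dart X)) x :
  subst_walk (word_value [::] cat (@walk_rev X) h x) =
  word_value [::] cat (@walk_rev Y) (fun i => subst_walk (h i)) x.
Proof.
elim: x => [//|[i b] x IH] /=; rewrite subst_walk_cat IH.
by case: b; rewrite //= subst_walk_rev.
Qed.

Lemma is_walk_subst (f : vertex X -> vertex Y) u v w :
  (forall d, is_walk (f (dart_src d)) (f (dart_tgt d)) (phi d)) ->
  is_walk u v w -> is_walk (f u) (f v) (subst_walk w).
Proof.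
move=> hd; elim: w u => [u /= ->//|d w IH u /= [<- /IH h]].
exact: is_walk_cat (hd d) h.
Qed.

End Substitution.

(** When [phi] after [psi] is the identity on homotopy classes, [phi] is
    surjective on edge-path groups and so carries generators to generators. *)
Lemma generates_transfer (X Y : graph) (f : vertex X -> vertex Y)
    (f' : vertex Y -> vertex X)
    (phi : dart X -> seq (dart Y)) (psi : dart Y -> seq (dart X)) u n h :
  (forall d, phi (dart_flip d) = walk_rev (phi d)) ->
  (forall d, psi (dart_flip d) = walk_rev (psi d)) ->
  (forall d, is_walk (f (dart_src d)) (f (dart_tgt d)) (phi d)) ->
  (forall d, is_walk (f' (dart_src d)) (f' (dart_tgt d)) (psi d)) ->
  f' (f u) = u ->
  (forall d, walk_homotopic (subst_walk phi (psi d)) [:: d]) ->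
  @generates _ (is_walk u u) (@walk_homotopic X) [::] cat (@walk_rev X) n h ->
  @generates _ (is_walk (f u) (f u)) (@walk_homotopic Y) [::] cat (@walk_rev Y) n
    (fun i => subst_walk phi (h i)).
Proof.
move=> phiF psiF phiW psiW f'f phipsi [hw hgen]; split.
  by move=> i; apply: is_walk_subst phiW (hw i).
have id_hom (w : seq (dart Y)) : walk_homotopic (subst_walk phi (subst_walk psi w)) w.
  elim: w => [|d w IH]; first exact: rst_refl.
  rewrite {2}/subst_walk /= subst_walk_cat -[X in walk_homotopic _ X]cat1s.
  exact: walk_homotopic_cat.
move=> w hwalk.
have [|x hx] := hgen (subst_walk psi w).
  by have := is_walk_subst psiW hwalk; rewrite f'f.
exists x; apply: walk_homotopic_trans (rst_sym _ _ _ _ (id_hom w)) _.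
rewrite -subst_walk_word//; exact: subst_walk_homotopic.
Qed.

(** * Developing carrier graphs in hyperbolic space *)

Section Voltages.
Context (R : realType) (Gamma : kleinian R) (X : graph) (g : edge X -> 'M[R]_4).
Local Notation G := (kleinian_set Gamma).
Hypothesis Gg : forall e, G (g e).

Definition volt (d : dart X) : 'M[R]_4 := if d.2 then (g d.1)^-1 else g d.1.

Definition wvolt (w : seq (dart X)) : 'M[R]_4 :=
  foldr (fun d A => volt d * A) 1 w.

Lemma volt_mem d : G (volt d).
Proof. by rewrite /volt; case: d.2; [apply: kleinianV|]; exact: Gg. Qed.

Lemma kleinian_unit A : G A -> A \is a GRing.unit.
Proof. by move=> GA; apply: isom_plus_unit; exact: (kleinian_isom GA). Qed.

Lemma volt_flip d : volt (dart_flip d) = (volt d)^-1.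
Proof. by case: d => e []; rewrite /volt /= ?invrK. Qed.

Lemma wvolt_mem w : G (wvolt w).
Proof.
elim: w => [|d w IH] /=; first exact: kleinian1.
by apply: kleinianM => //; exact: volt_mem.
Qed.

Lemma wvolt_cat w1 w2 : wvolt (w1 ++ w2) = wvolt w1 * wvolt w2.
Proof. by elim: w1 => [|d w IH] /=; rewrite ?mul1r// IH mulrA. Qed.

Lemma wvolt_rev w : wvolt (walk_rev w) = (wvolt w)^-1.
Proof.
elim: w => [|d w IH]; first by rewrite /= invr1.
rewrite walk_rev_cons wvolt_cat IH /= mulr1 volt_flip invrM//.
  by apply: kleinian_unit; exact: volt_mem.
by apply: kleinian_unit; exact: wvolt_mem.
Qed.

Lemma wvolt_homotopic w w' : walk_homotopic w w' -> wvolt w = wvolt w'.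
Proof.
elim=> // [a b [c1 [c2 [d [-> ->]]]]|a b c _ -> _ ->//].
rewrite !wvolt_cat /= volt_flip (mulrA (volt d)) mulrV ?mul1r//.
by apply: kleinian_unit; exact: volt_mem.
Qed.

Lemma wvolt_word n (h : 'I_n -> seq (dart X)) x :
  wvolt (word_value [::] cat (@walk_rev X) h x) =
  word_value 1 *%R GRing.inv (fun i => wvolt (h i)) x.
Proof.
elim: x => [//|[i b] x IH] /=; rewrite wvolt_cat IH.
by case: b; rewrite //= wvolt_rev.
Qed.

End Voltages.

Section Development.
Context (R : realType) (Gamma : kleinian R).
Local Notation G := (kleinian_set Gamma).
Local Notation M := (manifold Gamma).
Local Notation pr := (@manifold_proj R Gamma).
Local Notation lifts := (@lifts R Gamma).

Lemma actVK A x : G A -> act A^-1 (act A x) = x.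
Proof.
move=> GA; have iA := kleinian_isom GA; have iV := kleinian_isom (kleinianV GA).
by rewrite -actM// mulVr ?act1//; exact: (kleinian_unit GA).
Qed.

(** A lift of a mapped graph to hyperbolic space: the vertices are lifted
    independently, and [g e] accounts for the lift of [e] ending at a translate
    of the chosen lift of its target. *)
Definition developed (X : graph) (fv : vertex X -> M) (fe : edge X -> R -> M)
    (P : vertex X -> H3 R) (g : edge X -> 'M[R]_4) : Prop :=
  [/\ forall e, G (g e), forall v, pr (P v) = fv v &
      forall e, lifts (fe e) (P (source e)) (act (g e) (P (target e)))].

Lemma dart_path_lifts X fv fe P g (d : dart X) : developed fv fe P g ->
  lifts (dart_path fe d) (P (dart_src d)) (act (volt g d) (P (dart_tgt d))).
Proof.
case=> Gg _ hl; rewrite /dart_path /volt /dart_src /dart_tgt.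
case: d => e [] /=; last exact: hl.
rewrite -[X in lifts _ X](actVK _ (Gg e)).
by apply: lifts_act; [exact: kleinianV|exact: lifts_rev].
Qed.

Lemma walk_path_lifts X fv fe P g (u v : vertex X) w : developed fv fe P g ->
  is_walk u v w -> lifts (walk_path fv fe v w) (P u) (act (wvolt g w) (P v)).
Proof.
move=> dev; have [Gg pP _] := dev.
elim: w u => [u /= ->|d w IH u /= [<- /IH h]].
  by rewrite act1 -pP; exact: lifts_cst.
apply: lifts_concat (dart_path_lifts d dev) _.
rewrite actM; last first.
- exact: (kleinian_isom (wvolt_mem Gg w)).
- exact: (kleinian_isom (volt_mem Gg d)).
by apply: lifts_act => //; exact: (volt_mem Gg d).
Qed.

Lemma word_value_lifts n (c : 'I_n -> R -> M) (A : 'I_n -> 'M[R]_4) a x :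
  (forall i, G (A i)) -> (forall i, lifts (c i) a (act (A i) a)) ->
  G (word_value 1 *%R GRing.inv A x) /\
  lifts (word_value (cst (pr a)) (@path_concat R M) (@path_rev R M) c x)
    a (act (word_value 1 *%R GRing.inv A x) a).
Proof.
move=> GA cA; elim: x => [|[i b] x [GI IH]] /=.
  by split; [exact: kleinian1|rewrite act1; exact: lifts_cst].
have GB : G (if b then (A i)^-1 else A i).
  by case: b => //; exact: kleinianV.
split; first exact: kleinianM.
rewrite actM; try exact: kleinian_isom; last exact: (kleinian_isom GI).
  apply: (lifts_concat (b := act (if b then (A i)^-1 else A i) a)).
    case: b GB => GB //; rewrite -[X in lifts _ X](actVK _ (GA i)).
    by apply: lifts_act => //; exact: lifts_rev.
  exact: lifts_act.
exact: (kleinian_isom GB).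
Qed.

(** The images of the generators of the graph generate the fundamental group of
    the manifold. *)
Lemma rank_le_generators X fv fe P g (v : vertex X) k m h :
  developed fv fe P g -> pi1_surjective fv fe -> pi1_rank R (fv v) k ->
  @generates _ (is_walk v v) (@walk_homotopic X) [::] cat (@walk_rev X) m h ->
  (k <= m)%N.
Proof.
move=> dev surj [_ min] [hw hgen]; have [Gg pP _] := dev.
apply: (min m (fun i => walk_path fv fe v (h i))).
have hl i := walk_path_lifts dev (hw i).
split.
  move=> i; have := lifts_is_path (hl i).
  by rewrite pr_act ?pP//; exact: (wvolt_mem Gg).
move=> p /surj[w [ww pw]]; have [x hx] := hgen w ww; exists x.
apply: path_homotopic_trans pw _.
have [_] := word_value_lifts x (fun i => wvolt_mem Gg (h i)) hl.
rewrite -(wvolt_word Gg) -(wvolt_homotopic Gg hx) pP.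
exact: lifts_homotopic (walk_path_lifts dev ww).
Qed.

Lemma development_exists (X : carrier_graph Gamma) : exists P g,
  developed (@cg_vertex _ _ X) (@cg_edge _ _ X) P g /\
  forall e : edge X, ((H3_dist (P (source e)) (act (g e) (P (target e))))%:E
    <= edge_length e)%E.
Proof.
have [P hP] := choice (fun v : vertex X => pr_surj (cg_vertex v)).
have he (e : edge X) : exists A, [/\ G A,
    lifts (cg_edge e) (P (source e)) (act A (P (target e))) &
    ((H3_dist (P (source e)) (act A (P (target e))))%:E <= edge_length e)%E].
  have [b [bl bd]] := path_lifting (cg_path e) (hP (source e)).
  have [_ _ e1] := lifts_is_path bl; have [_ _ e1'] := cg_path e.
  have /pr_eq[A GA bE] : pr (P (target e)) = pr b by rewrite hP -e1' e1.
  by exists A; rewrite -bE.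
have [g hg] := choice he; exists P, g; split; last by move=> e; case: (hg e).
by split=> // e; case: (hg e).
Qed.

Lemma developed_gauge X fv fe P g (h : vertex X -> 'M[R]_4) :
  developed fv fe P g -> (forall v, G (h v)) ->
  let P' v := act (h v) (P v) in
  let g' e := h (source e) * g e * (h (target e))^-1 in
  developed fv fe P' g' /\
  forall e, act (g' e) (P' (target e)) = act (h (source e)) (act (g e) (P (target e))).
Proof.
move=> [Gg pP hl] Gh P' g'.
have Gg' e : G (g' e) by apply: kleinianM; [exact: kleinianM|exact: kleinianV].
have E e : act (g' e) (P' (target e)) = act (h (source e)) (act (g e) (P (target e))).
  rewrite /P' -!actM; try exact: kleinian_isom.
  by rewrite /g' divrK//; exact: kleinian_unit.
split=> //; split=> // [v|e]; first by rewrite /P' pr_act.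
by rewrite E; apply: lifts_act.
Qed.

(** If [phi] preserves the deck transformations of walks, then a loop in the
    manifold, moved to the given carrier graph [X], is homotopic to a walk of [X]
    whose image in [Y] has the same deck transformation; so [Y] carries the
    fundamental group wherever its vertices are placed. Its rank is at most [k]
    because generators are transferred by [phi], and at least [k] because it
    surjects onto a group of rank [k]. *)
Lemma competitor_exists (k : nat) (X : carrier_graph Gamma) P g (Y : graph)
    (f : vertex X -> vertex Y) (f' : vertex Y -> vertex X)
    (phi : dart X -> seq (dart Y)) (psi : dart Y -> seq (dart X))
    (P' : vertex Y -> H3 R) (g' : edge Y -> 'M[R]_4) :
  (forall x : M, pi1_rank R x k) ->
  developed (@cg_vertex _ _ X) (@cg_edge _ _ X) P g ->
  trivalent Y -> cancel f f' -> cancel f' f ->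
  (forall d, phi (dart_flip d) = walk_rev (phi d)) ->
  (forall d, psi (dart_flip d) = walk_rev (psi d)) ->
  (forall d, is_walk (f (dart_src d)) (f (dart_tgt d)) (phi d)) ->
  (forall d, is_walk (f' (dart_src d)) (f' (dart_tgt d)) (psi d)) ->
  (forall d, walk_homotopic (subst_walk phi (psi d)) [:: d]) ->
  (forall e, G (g' e)) -> (forall d, wvolt g' (phi d) = volt g d) ->
  exists Z : carrier_graph Gamma, (graph_length Z <=
    (\sum_(e : edge Y) H3_dist (P' (source e)) (act (g' e) (P' (target e))))%:E)%E.
Proof.
move=> Mk dev triv ff' f'f phiF psiF phiW psiW phipsi Gg' voltE.
have [Gg pP _] := dev.
pose fv v := pr (P' v).
pose fe e := geodesic_path Gamma (P' (source e)) (act (g' e) (P' (target e))).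
have devY : developed fv fe P' g' by split=> // e; exact: lifts_geodesic.
have wvoltE w : wvolt g' (subst_walk phi w) = wvolt g w.
  elim: w => [//|d w IH]; rewrite /subst_walk /= wvolt_cat voltE.
  by rewrite -/(subst_walk phi w) IH.
have surj : pi1_surjective fv fe.
  move=> y p hp.
  have [b [pb _]] := path_lifting hp (erefl (pr (P' y))).
  have [_ _ p1] := hp; have [_ _ p1'] := lifts_is_path pb.
  have /pr_eq[B GB bE] : pr (P' y) = pr b by rewrite -p1' p1.
  pose x := f' y.
  have ql := lifts_geodesic Gamma (P x) (act B (P x)).
  have [|w [ww qw]] := @cg_surjective _ _ X x (geodesic_path Gamma (P x) (act B (P x))).
    by have := lifts_is_path ql; rewrite pr_act// pP.
  exists (subst_walk phi w).
  have wY : is_walk y y (subst_walk phi w).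
    by have := is_walk_subst phiW ww; rewrite f'f.
  split=> //.
  have cl := lifts_geodesic Gamma (P' y) (P x).
  have crl := lifts_rev cl.
  have lw := walk_path_lifts dev ww.
  have GW := wvolt_mem Gg w.
  (* conjugating by a path between the two base points *)
  apply: (path_homotopic_trans (q := path_concat (geodesic_path Gamma (P' y) (P x))
     (path_concat (geodesic_path Gamma (P x) (act B (P x)))
       (path_rev (geodesic_path Gamma (P' y) (P x)))))).
    apply: (lifts_homotopic pb); rewrite bE.
    by apply: lifts_concat cl _; apply: lifts_concat ql _; exact: lifts_act.
  apply: (path_homotopic_trans (q := path_concat (geodesic_path Gamma (P' y) (P x))
     (path_concat (walk_path (@cg_vertex _ _ X) (@cg_edge _ _ X) x w)
       (path_rev (geodesic_path Gamma (P' y) (P x)))))).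
    apply: path_concat_homotopic; last apply: path_concat_homotopic => //.
    - have [_ _ ->] := lifts_is_path cl.
      have [_ -> _] := lifts_is_path (lifts_concat ql (lifts_act GB crl)).
      by [].
    - exact: (lifts_homotopic cl cl).
    - have [_ _ ->] := lifts_is_path ql; rewrite pr_act//.
      by have [_ -> _] := lifts_is_path crl.
    - exact: (lifts_homotopic crl crl).
  apply: lifts_homotopic (walk_path_lifts devY wY).
  rewrite wvoltE; apply: lifts_concat cl _; apply: lifts_concat lw _.
  exact: lifts_act.
have conn : graph_connected Y.
  have [V0 connX] := cg_connected X; split.
    by have /card_gt0P[v _] := V0; apply/card_gt0P; exists (f v).
  move=> u v; have [w hw] := connX (f' u) (f' v); exists (subst_walk phi w).
  by have := is_walk_subst phiW hw; rewrite !f'f.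
have rk (y : vertex Y) : graph_pi1_rank y k.
  split; last first.
    move=> m h hg; exact: (rank_le_generators devY surj (Mk (fv y)) hg).
  have /cg_rank[[h hgen] _] := Mk (@cg_vertex _ _ X (f' y)).
  have := generates_transfer phiF psiF phiW psiW (ff' (f' y)) phipsi hgen.
  by rewrite f'f => h'; exists (fun i => subst_walk phi (h i)).
have rank_uniq (T : Type) (mem : set T) eqv one mul inv n m :
    @has_rank T mem eqv one mul inv n -> has_rank mem eqv one mul inv m -> n = m.
  move=> [[h1 g1] m1] [[h2 g2] m2]; apply/eqP.
  by rewrite eqn_leq (m1 _ _ g2) (m2 _ _ g1).
have path_e (e : edge Y) : is_path (fv (source e)) (fv (target e)) (fe e).
  by have [_ _ /(_ e) /lifts_is_path] := devY; rewrite pr_act.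
have rank_iff (y : vertex Y) n : graph_pi1_rank y n <-> pi1_rank R (fv y) n.
  split=> h.
    by rewrite (rank_uniq _ _ _ _ _ _ _ _ h (rk y)).
  by rewrite (rank_uniq _ _ _ _ _ _ _ _ h (Mk (fv y))).
exists (CarrierGraph path_e conn triv surj rank_iff).
rewrite /graph_length -sumEFin; apply: lee_sum => e _.
exact: geodesic_path_length.
Qed.

End Development.

(** * Forests in graphs *)

Section Reduced.
Context (X : graph).
Implicit Types (u v t : vertex X) (d : dart X) (w : seq (dart X)).

Definition reduced w : bool := sorted (fun d d' : dart X => d' != dart_flip d) w.

Lemma unreducedP w : ~~ reduced w ->
  exists w1 d w2, w = w1 ++ d :: dart_flip d :: w2.
Proof.
elim: w => [//|d w IH].
have [/IH [w1 [d' [w2 ->]]] _|] := boolP (~~ reduced w).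
  by exists (d :: w1), d', w2.
rewrite negbK; case: w {IH} => [//|d' w] h.
rewrite /reduced /= -/(sorted _ (d' :: w)) in h *.
rewrite negb_and h orbF negbK => /eqP ->.
by exists [::], d, w.
Qed.

Lemma reduced_catl w1 w2 : reduced (w1 ++ w2) -> reduced w1.
Proof. by case: w1 => [//|d w1]; rewrite /reduced /= cat_path => /andP[]. Qed.

Lemma reduced_cons d w : reduced (d :: w) -> reduced w.
Proof. by apply: path_sorted. Qed.

(** Cancel backtracks as long as there are any. *)
Lemma reduce_walk u v w : is_walk u v w -> exists w',
  [/\ is_walk u v w', reduced w', walk_homotopic w w' & {subset w' <= w}].
Proof.
have [n] := ubnP (size w); elim: n => // n IH in w *; rewrite ltnS => sw hw.
have [rw|/unreducedP[w1 [d [w2 wE]]]] := boolP (reduced w).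
  by exists w; split=> //; exact: rst_refl.
have [||w' [h1 h2 h3 h4]] := IH (w1 ++ w2).
- by apply: leq_trans sw; rewrite wE !size_cat /= !addnS ltnS; lia.
- move: hw; rewrite wE => /is_walk_catE[a [hw1 /= [da [_ hw2]]]].
  by apply: is_walk_cat hw1 _; rewrite dart_tgt_flip da in hw2.
exists w'; split=> //.
  by apply: rst_trans h3; apply: rst_step; exists w1, w2, d.
move=> x /h4; rewrite wE !mem_cat !inE => /orP[->//|->].
by rewrite !orbT.
Qed.

Lemma walk_first_visit u v w t : is_walk u v w ->
  t \in rcons (map (@dart_src X) w) v -> exists w1 w2,
  [/\ w = w1 ++ w2, is_walk u t w1 & t \notin map (@dart_src X) w1].
Proof.
elim: w u => [|d w IH] u /=; first by move=> ->; rewrite inE => /eqP ->; exists [::], [::].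
move=> [<- hw]; rewrite inE; have [->|tn] := eqVneq t (dart_src d).
  by move=> _; exists [::], (d :: w).
move=> /= /(IH _ hw)[w1 [w2 [-> h1 h2]]]; exists (d :: w1), w2; split=> //.
by rewrite inE negb_or tn.
Qed.

(** In a closed or open walk that repeats no starting point, an edge can only
    recur by turning back at once. *)
Lemma reduced_uniq_edges u v w : is_walk u v w -> reduced w ->
  uniq (map (@dart_src X) w) -> uniq (map fst w).
Proof.
elim: w u => [//|d w IH] u /= [_ hw] rw /andP[dn uw].
rewrite (IH _ hw (reduced_cons rw) uw) andbT.
apply/negP => /mapP[d' d'w ee].
have [e|ne] := eqVneq d' d.
  by move: dn; rewrite -e (map_f (@dart_src X)).
have d'E : d' = dart_flip d.
  move: ee ne; rewrite /dart_flip; case: d {hw rw dn} => e b; case: d' {d'w} => e' b' /= ->.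
  by rewrite -pair_eqE /pair_eq /= eqxx /=; case: b b' => [] [].
case: w hw rw uw d'w {IH dn} => [//|c w] /= [hc hw] /andP[cn _] /andP[cw _].
rewrite inE; have [e|_] := eqVneq d' c; first by rewrite -e d'E eqxx in cn.
move=> /= d'w; move: cw; rewrite hc -dart_src_flip -d'E.
by rewrite (map_f (@dart_src X)).
Qed.

Context (S : pred (edge X)).
Hypothesis acyclic : forall c, is_circuit c -> ~~ all (fun d : dart X => S d.1) c.

(** At the first return to an earlier vertex a reduced walk would close up a
    circuit. *)
Lemma forest_uniq_vertices u v w : is_walk u v w -> reduced w ->
  all (fun d : dart X => S d.1) w -> uniq (rcons (map (@dart_src X) w) v).
Proof.
elim: w u => [//|d w IH] u hw rw /= /andP[Sd Sw].
have [/= _ hw'] := hw.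
have uw := IH _ hw' (reduced_cons rw) Sw; rewrite uw andbT.
apply/negP => din; have [w1 [w2 [wE h1 h2]]] := walk_first_visit hw' din.
have hc : is_walk (dart_src d) (dart_src d) (d :: w1) by [].
have usrc : uniq (map (@dart_src X) (d :: w1)).
  rewrite /= h2 /=; move: uw; rewrite wE map_cat rcons_cat cat_uniq.
  by case/andP.
have rc : reduced (d :: w1) by move: rw; rewrite wE -cat_cons => /reduced_catl.
have := acyclic (c := d :: w1); rewrite /= Sd /=.
have -> : all (fun d : dart X => S d.1) w1.
  by move: Sw; rewrite wE all_cat => /andP[].
move=> h; suff /h : is_circuit (d :: w1) by [].
split=> //; first by exists (dart_src d).
exact: reduced_uniq_edges hc rc usrc.
Qed.

Lemma forest_walk_size u v w : is_walk u v w -> reduced w ->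
  all (fun d : dart X => S d.1) w -> (size w < #|vertex X|)%N.
Proof.
move=> hw rw Sw; have := forest_uniq_vertices hw rw Sw.
move=> /card_uniqP; rewrite size_rcons size_map => <-; exact: max_card.
Qed.

Lemma forest_closed_walk u w : is_walk u u w -> reduced w ->
  all (fun d : dart X => S d.1) w -> w = [::].
Proof.
move=> hw rw Sw; have := forest_uniq_vertices hw rw Sw.
case: w hw {rw Sw} => [//|d w] /= [-> _].
by rewrite mem_rcons inE eqxx.
Qed.

(** Reduced walks in a forest are simple, hence of bounded length; a longest one
    that starts with [d0] must end at a leaf. *)
Lemma forest_leaf d0 : S d0.1 -> exists s : dart X,
  [/\ S s.1, dart_src s != dart_src d0,
      exists2 w, is_walk (dart_src d0) (dart_src s) w &
        all (fun d : dart X => S d.1) w &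
      forall d, S d.1 -> dart_src d = dart_src s -> d = s].
Proof.
move=> Sd0.
pose Q n := `[< exists w v, [/\ size w = n, is_walk (dart_src d0) v (d0 :: w),
  reduced (d0 :: w) & all (fun d : dart X => S d.1) (d0 :: w)] >].
have Q0 : exists n, Q n.
  by exists 0%N; apply/asboolP; exists [::], (dart_tgt d0); rewrite /= Sd0.
have Qb n : Q n -> (n <= #|vertex X|)%N.
  move=> /asboolP[w [v [<- hw rw Sw]]]; have := forest_walk_size hw rw Sw.
  by rewrite /=; lia.
case: (ex_maxnP Q0 Qb) => n /asboolP[w [v [sw hw rw Sw]]] maxn.
have lastE : dart_tgt (last d0 w) = v.
  have [_] := hw; elim: (w) (d0) => [|d w' IH] d1 //=.
  by case=> _ /IH.
have Sl : S (last d0 w).1 by have /allP := Sw; apply; exact: mem_last.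
exists (dart_flip (last d0 w)); rewrite dart_src_flip lastE; split=> //.
- have := forest_uniq_vertices hw rw Sw; rewrite /= => /andP[+ _].
  by rewrite mem_rcons inE negb_or eq_sym => /andP[].
- by exists (d0 :: w).
move=> d Sd dv; apply/eqP; rewrite -[_ == _]negbK; apply/negP => dn.
suff : Q n.+1 by move=> /maxn; rewrite ltnn.
apply/asboolP; exists (rcons w d), (dart_tgt d); split.
- by rewrite size_rcons sw.
- by rewrite -rcons_cons -cats1; apply: is_walk_cat hw _.
- by rewrite /reduced /= rcons_path; move: rw; rewrite /reduced /= => ->.
- by rewrite -rcons_cons all_rcons Sd.
Qed.

End Reduced.

(** * Rewiring a trivalent graph *)

Lemma card_darts (Y : graph) (v : vertex Y) :
  degree v = #|[set d : edge Y * bool | dart_src (d : dart Y) == v]%SET|.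
Proof.
rewrite /degree addnC.
have -> : [set d : edge Y * bool | dart_src (d : dart Y) == v]%SET =
  ((fun e => (e, true)) @: [set e | target e == v]%SET :|:
   (fun e => (e, false)) @: [set e | source e == v]%SET)%SET.
  apply/setP => -[e b]; rewrite !inE.
  apply/idP/orP.
    by case: b => h; [left|right]; apply/imsetP; exists e; rewrite ?inE.
  by case=> /imsetP[e' + [-> ->]]; rewrite inE.
rewrite cardsU !card_imset; try by move=> ? ? [].
set I := (_ :&: _)%SET; suff -> : I = finset.set0 by rewrite cards0 subn0.
apply/setP => -[e b]; rewrite !inE; apply/negP => /andP[/imsetP[? _ [_ ->]]].
by case/imsetP.
Qed.

Section Rewire.
Context (X : graph) (pi : {perm (edge X * bool)}).

(** Permuting the points where the darts are attached preserves all degrees. *)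
Definition rewire : graph :=
  @Graph (vertex X) (edge X)
    (fun e => dart_src (pi (e, false) : dart X))
    (fun e => dart_src (pi (e, true) : dart X)).

Lemma rewire_src (d : dart X) : @dart_src rewire d = dart_src (pi d : dart X).
Proof. by case: d => e []. Qed.

Lemma rewire_tgt (d : dart X) :
  @dart_tgt rewire d = dart_src (pi (dart_flip d) : dart X).
Proof. by case: d => e []. Qed.

Lemma rewire_trivalent : trivalent X -> trivalent rewire.
Proof.
move=> triv v; rewrite card_darts -(triv v) card_darts.
rewrite -(card_imset _ (@perm_inj _ pi)); apply: eq_card => d.
rewrite !inE; apply/imsetP/idP => [[d' + ->]|dv]; first by rewrite inE rewire_src.
by exists (pi^-1 d)%g; rewrite ?inE ?rewire_src permKV.
Qed.

Context (T : pred (edge X)) (C : pred (vertex X)) (v0 : vertex X).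
Context (rho : vertex X -> seq (dart X)).
Hypothesis pi_tree : forall d, T d.1 -> pi d = d.
Hypothesis pi_C : forall d : dart X,
  dart_src (pi d : dart X) = dart_src d \/
  C (dart_src d) /\ C (dart_src (pi d : dart X)).
Hypothesis rho_tree : forall v, all (fun d : dart X => T d.1) (rho v).
Hypothesis rhoC : forall v, C v -> is_walk v0 v (rho v).
Hypothesis rhoN : forall v, ~~ C v -> rho v = [::].

(** Along the tree, from the old to the new starting point of [d]. *)
Definition slide (d : dart X) : seq (dart X) :=
  walk_rev (rho (dart_src d)) ++ rho (dart_src (pi d : dart X)).

(** Deform [X] into its rewiring: go along the tree to where [d] is now attached,
    through [d], and back along the tree at the other end. *)
Definition to_rewire (d : dart X) : seq (dart rewire) :=
  slide d ++ d :: walk_rev (slide (dart_flip d)).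

Definition of_rewire (d : dart rewire) : seq (dart X) :=
  walk_rev (slide d) ++ (d : dart X) :: slide (dart_flip (d : dart X)).

Lemma slide_tree d : all (fun d : dart X => T d.1) (slide d).
Proof.
rewrite all_cat rho_tree andbT /walk_rev all_rev all_map.
exact: rho_tree.
Qed.

Lemma rewire_walk u v w : all (fun d : dart X => T d.1) w ->
  @is_walk X u v w -> @is_walk rewire u v w.
Proof.
elim: w u => [//|d w IH] u /= /andP[Td Tw] [du hw]; split.
  by rewrite rewire_src pi_tree.
have -> : dart_tgt (d : dart rewire) = dart_tgt d :> vertex X.
  by rewrite rewire_tgt pi_tree// dart_src_flip.
exact: IH.
Qed.

Lemma slide_walk d : is_walk (dart_src d) (dart_src (pi d : dart X)) (slide d).
Proof.
rewrite /slide; case: (pi_C d) => [->|[/rhoC h1 /rhoC h2]].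
  have [/rhoC h|/rhoN ->//] := boolP (C (dart_src d)).
  exact: (is_walk_cat (is_walk_rev h) h).
exact: (is_walk_cat (is_walk_rev h1) h2).
Qed.

Lemma to_rewire_flip d : to_rewire (dart_flip d) = @walk_rev rewire (to_rewire d).
Proof.
have revK w : @walk_rev rewire (@walk_rev X w) = w by exact: (@walk_revK X).
rewrite /to_rewire [RHS](@walk_rev_cat rewire (slide d)).
by rewrite [X in _ = X ++ _]walk_rev_cons revK -catA !dart_flipK.
Qed.

Lemma of_rewire_flip d : of_rewire (dart_flip d) = walk_rev (of_rewire d).
Proof.
rewrite /of_rewire [RHS]walk_rev_cat [X in _ = X ++ _]walk_rev_cons walk_revK.
by rewrite -catA !dart_flipK.
Qed.

Lemma to_rewire_walk d :
  @is_walk rewire (@dart_src X d) (@dart_tgt X d) (to_rewire d).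
Proof.
apply: is_walk_cat.
  exact: (rewire_walk (slide_tree d) (slide_walk d)).
split; first by rewrite rewire_src.
rewrite rewire_tgt -dart_src_flip; apply: (is_walk_rev (X := rewire)).
exact: (rewire_walk (slide_tree _) (slide_walk _)).
Qed.

Lemma of_rewire_walk d :
  @is_walk X (@dart_src rewire d) (@dart_tgt rewire d) (of_rewire d).
Proof.
rewrite rewire_src rewire_tgt; apply: is_walk_cat.
  by apply: is_walk_rev; exact: slide_walk.
by split=> //; rewrite -dart_src_flip; exact: slide_walk.
Qed.

(** A dart of the tree is not reattached, so that its slide goes back and forth
    along the same walk. *)
Lemma slide_tree_dart d : T d.1 -> walk_homotopic (slide d) [::].
Proof. by move=> Td; rewrite /slide pi_tree//; exact: walk_homotopic_revl. Qed.

Lemma to_rewire_tree w : all (fun d : dart X => T d.1) w ->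
  @walk_homotopic rewire (subst_walk to_rewire w) w.
Proof.
elim: w => [_|d w IH /= /andP[Td Tw]]; first exact: rst_refl.
rewrite /subst_walk /= -[X in walk_homotopic _ X]cat1s.
apply: (walk_homotopic_cat (X := rewire)); last exact: IH.
have h1 : @walk_homotopic rewire (slide d) [::] := slide_tree_dart Td.
have h2 : @walk_homotopic rewire (walk_rev (slide (dart_flip d))) [::].
  exact: (walk_homotopic_rev (slide_tree_dart (d := dart_flip d) Td)).
rewrite /to_rewire -[d :: walk_rev _]cat1s.
apply: (walk_homotopic_trans (X := rewire) (w2 := [::] ++ [:: d] ++ [::])).
  apply: (walk_homotopic_cat (X := rewire)) => //.
  by apply: (walk_homotopic_cat (X := rewire)) => //; exact: rst_refl.
exact: rst_refl.
Qed.

(** The slides along the tree cancel, as [to_rewire] is the identity on the tree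
    up to homotopy. *)
Lemma to_of_rewire d :
  @walk_homotopic rewire (subst_walk to_rewire (of_rewire d)) [:: d].
Proof.
have h1 := to_rewire_tree (slide_tree d).
have h2 := to_rewire_tree (slide_tree (dart_flip (d : dart X))).
rewrite /of_rewire subst_walk_cat (subst_walk_rev to_rewire_flip).
rewrite -[(d : dart X) :: _]cat1s subst_walk_cat.
rewrite {2}/subst_walk /= cats0.
apply: (walk_homotopic_trans (X := rewire) (w2 := walk_rev (slide d) ++
  to_rewire d ++ slide (dart_flip (d : dart X)))).
  apply: (walk_homotopic_cat (X := rewire)); first exact: (walk_homotopic_rev (X := rewire)).
  by apply: (walk_homotopic_cat (X := rewire)) => //; exact: rst_refl.
exact: (@walk_homotopic_conj X).
Qed.

End Rewire.

(** * The number of edges of a trivalent graph of given rank *)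

Section CycleSpace.
Context (X : graph).
Local Notation n := #|edge X|.
Local Notation m := #|vertex X|.
Implicit Types (w : seq (dart X)).

Lemma F2_addrr p (A : 'M['F_2]_(p, n)) : A + A = 0.
Proof.
apply/matrixP => i j; rewrite !mxE.
by case: (A i j) => -[|[|//]] h; apply/val_inj.
Qed.

(** The class of a word in the first chain group modulo 2. *)
Definition chain w : 'rV['F_2]_n := \sum_(d <- w) delta_mx 0 (enum_rank d.1).

Lemma chain_cat w1 w2 : chain (w1 ++ w2) = chain w1 + chain w2.
Proof. by rewrite /chain big_cat. Qed.

Lemma chain_rev w : chain (walk_rev w) = chain w.
Proof.
rewrite /chain /walk_rev (perm_big (map (@dart_flip X) w)) ?perm_rev//=.
by rewrite big_map.
Qed.

Lemma chain_homotopic w w' : walk_homotopic w w' -> chain w = chain w'.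
Proof.
elim=> // [a b [c1 [c2 [d [-> ->]]]]|a b c _ -> _ ->//].
rewrite !chain_cat; congr (_ + _).
by rewrite {1}/chain !big_cons addrA F2_addrr add0r.
Qed.

Definition boundary : 'M['F_2]_(n, m) :=
  \matrix_(i, j) ((source (enum_val i) == enum_val j)%:R +
                  (target (enum_val i) == enum_val j)%:R).

(** Every cycle is the sum of the based loops running through its edges, so
    generators of the edge-path group span the cycles. *)
Lemma cycle_space_rank (v : vertex X) k (h : 'I_k -> seq (dart X)) :
  graph_connected X ->
  generates (is_walk v v) (@walk_homotopic X) [::] cat (@walk_rev X) h ->
  (n - m <= k)%N.
Proof.
move=> [_ conn] [hw hgen].
have [p hp] := choice (fun u => conn v u).
pose Pm : 'M['F_2]_(m, n) := \matrix_i chain (p (enum_val i)).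
pose Gm : 'M['F_2]_(k, n) := \matrix_i chain (h i).
pose loop e := p (source e) ++ (e, false) :: walk_rev (p (target e)).
have loopE i : row i (boundary *m Pm + 1%:M) = chain (loop (enum_val i)).
  rewrite /loop chain_cat -cat1s chain_cat chain_rev {2}/chain big_seq1 /=.
  rewrite enum_valK raddfD /= row1 row_mul.
  have -> : row i boundary = delta_mx 0 (enum_rank (source (enum_val i))) +
                           delta_mx 0 (enum_rank (target (enum_val i))).
    apply/rowP => j; rewrite !mxE eqxx /= -(inj_eq enum_val_inj) enum_rankK.
    rewrite -[in X in _ = _ + X](inj_eq enum_val_inj) enum_rankK.
    by rewrite ![enum_val j == _]eq_sym.
  by rewrite mulmxDl -!rowE !rowK !enum_rankK addrAC -addrA.
have loopG : ((boundary *m Pm + 1%:M)%R <= Gm)%MS.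
  apply/row_subP => i; rewrite loopE.
  have [|x hx] := hgen (loop (enum_val i)).
    by apply: (is_walk_cat (hp _)); split=> //; exact: is_walk_rev (hp _).
  rewrite (chain_homotopic hx).
  elim: x {hx} => [|[j b] x IH] /=; first by rewrite /chain big_nil sub0mx.
  rewrite chain_cat addmx_sub//.
  have -> : chain (if b then walk_rev (h j) else h j) = row j Gm.
    by rewrite rowK; case: b => //; rewrite chain_rev.
  exact: row_sub.
have kerG : (kermx boundary <= Gm)%MS.
  apply: submx_trans loopG.
  have -> : kermx boundary = kermx boundary *m (boundary *m Pm + 1%:M).
    by rewrite mulmxDr mulmxA mulmx_ker mul0mx add0r mulmx1.
  exact: submxMl.
have := mxrankS kerG; rewrite mxrank_ker.
have := rank_leq_row Gm; have := rank_leq_col boundary; lia.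
Qed.

Lemma trivalent_card : trivalent X -> (2 * n = 3 * m)%N.
Proof.
move=> triv; have : #|{: edge X * bool}| = (2 * n)%N by rewrite card_prod card_bool mulnC.
move=> <-; rewrite -sum1_card (partition_big (fun d : dart X => dart_src d) predT)//=.
rewrite (eq_bigr (fun=> 3%N)); first by rewrite sum_nat_const mulnC.
by move=> v _; rewrite -(triv v) card_darts -sum1_card; apply: eq_bigl => d; rewrite inE.
Qed.

(** Since [2 * n = 3 * m], the bound [n - m <= k] is one on [n]. *)
Lemma trivalent_rank_card (v : vertex X) k : graph_connected X -> trivalent X ->
  graph_pi1_rank v k -> (n <= 3 * k)%N.
Proof.
move=> conn triv [[h hgen] _].
by have := cycle_space_rank conn hgen; have := trivalent_card triv; lia.
Qed.

End CycleSpace.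

(** * Shortening a graph at a crowded vertex *)

Lemma perm_two_points (T : finType) (i j a b : T) : i != j -> a != b ->
  exists s : {perm T}, [/\ s i = a, s j = b &
    forall x, s x != x -> [|| x == i, x == j, x == a | x == b]].
Proof.
move=> ij ab; pose j' := tperm i a j.
have j'a : j' != a.
  by rewrite /j' -{2}(tpermL i a) (inj_eq perm_inj) eq_sym.
exists (tperm i a * tperm j' b)%g; split.
- by rewrite permM tpermL tpermD// eq_sym.
- by rewrite permM -/j' tpermL.
move=> x; apply: contraR; rewrite !negb_or => /and4P[xi xj xa xb].
have e1 : tperm i a x = x by rewrite tpermD// eq_sym.
rewrite permM e1 tpermD ?eqxx//; last by rewrite eq_sym.
by rewrite /j' eq_sym; case: tpermP.
Qed.

Lemma sum_over_three (R : realType) (T : finType) (A : pred T) (F : T -> R) i j b :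
  #|A| = 3%N -> A i -> A j -> i != j -> (forall x, A x -> F x <= b) ->
  \sum_(x | A x) F x <= F i + F j + b.
Proof.
move=> A3 Ai Aj ij Fb; rewrite (bigD1 i)//= (bigD1 j) /=; last by rewrite Aj eq_sym.
rewrite addrA lerD2l.
apply: (@le_trans _ _ (\sum_(x | A x && (x != i) && (x != j)) b)).
  by apply: ler_sum => x /andP[/andP[/Fb]].
rewrite sumr_const; set c := #|_|; suff -> : c = 1%N by rewrite mulr1n.
have := cardD1 i A; rewrite A3 [i \in A]Ai => -[].
rewrite (cardD1 j) inE /= [j \in A]Aj eq_sym ij => -[e].
rewrite /c e; apply: eq_card => x; rewrite !inE /=.
by rewrite andbC; congr andb; rewrite andbC.
Qed.

Lemma star_gain_arith (R : realType) (x y z rho : R) :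
  x + y + z <= 2 * rho - rho / 2000 ->
  (y - rho) + (z - rho) + x <= - (rho / 2000).
Proof. lra. Qed.

Section Surgery.
Context (R : realType) (Gamma : kleinian R) (X : graph).
Local Notation G := (kleinian_set Gamma).
Context (Q : vertex X -> H3 R) (g : edge X -> 'M[R]_4).
Hypothesis Gg : forall e, G (g e).
Context (C : pred (vertex X)) (short : pred (edge X)) (o : H3 R) (rho : R).
Hypothesis QC : forall v, C v -> Q v = o.
Hypothesis triv : trivalent X.

Definition edge_dist (Q : vertex X -> H3 R) (e : edge X) (d1 d2 : dart X) : R :=
  H3_dist (Q (dart_src d1)) (act (g e) (Q (dart_src d2))).

Definition edge_len e := edge_dist Q e (e, false) (e, true).
Local Notation len := edge_len.

Hypothesis rho_gt0 : 0 < rho.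
Hypothesis rho_le : rho <= 2^-1.
Hypothesis long : forall e, ~~ short e -> 2 * rho <= len e.

(** For a reversed dart the point is taken near the end of the lifted edge, and
    then carried back to the chosen lift of the target. *)
Definition cut (d : dart X) : H3 R :=
  let a := Q (source d.1) in let b := act (g d.1) (Q (target d.1)) in
  if d.2 then act (g d.1)^-1 (H3_geodesic a b (1 - rho / len d.1))
  else H3_geodesic a b (rho / len d.1).

Lemma cut_dist d : ~~ short d.1 -> H3_dist (Q (dart_src d)) (cut d) = rho.
Proof.
case: d => e b /= /long l2; rewrite /cut /dart_src /=.
have l0 : 0 < len e by have := rho_gt0; lra.
have iV := kleinian_isom (kleinianV (Gg e)).
have ln0 : len e != 0 by rewrite gt_eqF.
case: b.
  rewrite -{1}[Q (target e)](actVK _ (Gg e)) act_dist// H3_distC.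
  rewrite -{2}(H3_geodesic1 (Q (source e)) (act (g e) (Q (target e)))).
  rewrite H3_dist_geodesic; last by rewrite lerBlDr lerDl divr_ge0// ltW.
  by rewrite -[X in _ * X]/(len e); field.
rewrite -{1}(H3_geodesic0 (Q (source e)) (act (g e) (Q (target e)))).
rewrite H3_dist_geodesic; last by rewrite divr_ge0// ltW.
by rewrite -[X in _ * X]/(len e); field.
Qed.

Lemma cut_middle e : ~~ short e ->
  H3_dist (cut (e, false)) (act (g e) (cut (e, true))) = len e - 2 * rho.
Proof.
move=> /long l2; rewrite /cut /=.
have l0 : 0 < len e by have := rho_gt0; lra.
have ln0 : len e != 0 by rewrite gt_eqF.
rewrite -(actM _ (kleinian_isom (Gg e)) (kleinian_isom (kleinianV (Gg e)))).
rewrite mulrV ?act1; last exact: (kleinian_unit (Gg e)).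
rewrite H3_dist_geodesic; last first.
  by rewrite lerBrDr -mulrDl ler_pdivrMr// mul1r; lra.
by rewrite -[X in _ * X]/(len e); field.
Qed.

Context (t : vertex X) (alpha beta : dart X) (leg : 'I_4 -> dart X).
Hypothesis Ct : C t.
Hypothesis ab : alpha != beta.
Hypothesis alphaP : dart_src alpha = t /\ ~~ short alpha.1.
Hypothesis betaP : dart_src beta = t /\ ~~ short beta.1.
Hypothesis leg_inj : injective leg.
Hypothesis legP : forall i, C (dart_src (leg i)) /\ ~~ short (leg i).1.

(** Reattach at [t] the two legs given by [star_split] for the cut points, and
    move [t] to the end of the stem. An edge is compared with the broken line
    through its cut points, so only the initial segments of darts starting at [t]
    matter. There are three of them: the two legs, and a third dart which grows
    by at most the length of the stem. *)
Lemma surgery : exists (pi : {perm (edge X * bool)}) (Q' : vertex X -> H3 R),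
  [/\ forall d, short d.1 -> pi d = d,
      forall d : dart X, dart_src (pi d : dart X) = dart_src d \/
        C (dart_src d) /\ C (dart_src (pi d : dart X)) &
      \sum_e edge_dist Q' e (pi (e, false)) (pi (e, true)) <=
      \sum_e len e - rho / 2000].
Proof.
have legdist i : hdist (\val o) (\val (cut (leg i))) = rho.
  have [Ci si] := legP i; rewrite -H3_distE -(QC Ci); exact: cut_dist.
have [i [j [o'v [ij ho' gain]]]] :=
  star_split rho_gt0 rho_le (H3P o) (fun i => H3P (cut (leg i))) legdist.
pose o' := H3_of o'v.
have o'E : \val o' = o'v by apply: H3_ofE.
rewrite -o'E in gain.
have {}gain : H3_dist o o' + H3_dist o' (cut (leg i)) +
  H3_dist o' (cut (leg j)) <= 2 * rho - rho / 2000 := gain.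
have lij : leg i != leg j by rewrite (inj_eq leg_inj).
have [pi [pii pij pi_moved]] := perm_two_points lij ab.
have movedP d : pi d != d -> C (dart_src (d : dart X)) /\ ~~ short d.1.
  move=> /pi_moved /or4P[] /eqP ->; try exact: legP.
    by have [-> ?] := alphaP.
  by have [-> ?] := betaP.
have pi_short d : short d.1 -> pi d = d.
  by move=> sd; apply/eqP/negPn/negP => /movedP[_]; rewrite sd.
have pi_C (d : dart X) : dart_src (pi d : dart X) = dart_src d \/
    C (dart_src d) /\ C (dart_src (pi d : dart X)).
  have [->|pd] := eqVneq (pi d) d; [by left|right].
  have [Cd _] := movedP _ pd; split=> //.
  by have [] := movedP (pi d); rewrite ?(inj_eq perm_inj).
have Qpi (d : dart X) : Q (dart_src (pi d : dart X)) = Q (dart_src d).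
  by case: (pi_C d) => [->//|[C1 C2]]; rewrite !QC.
pose Q' v := if v == t then o' else Q v.
have Q'N v : v != t -> Q' v = Q v by rewrite /Q' => /negbTE ->.
(* bound on the change in length of the initial part of [d] *)
pose delta (d : dart X) := if short d.1
  then H3_dist (Q' (dart_src (pi d : dart X))) (Q (dart_src d))
  else H3_dist (Q' (dart_src (pi d : dart X))) (cut d) - rho.
exists pi, Q'; split=> //.
have step e : edge_dist Q' e (pi (e, false)) (pi (e, true)) <=
    len e + (delta (e, false) + delta (e, true)).
  have ig := kleinian_isom (Gg e).
  rewrite /edge_dist /delta /=; set a := Q' _; set b := Q' _.
  have [se|le] := boolP (short e).
    apply: le_trans (H3_dist_triangle (Q (dart_src ((e, false) : dart X))) _ _) _.
    rewrite addrCA lerD2l (H3_distC b).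
    rewrite -(act_dist (Q (dart_src ((e, true) : dart X))) b ig).
    exact: (H3_dist_triangle (act (g e) (Q (dart_src ((e, true) : dart X))))).
  rewrite (_ : len e + _ = H3_dist a (cut (e, false)) +
    ((len e - 2 * rho) + H3_dist b (cut (e, true)))); last by ring.
  apply: le_trans (H3_dist_triangle (cut (e, false)) _ _) _.
  rewrite lerD2l (H3_distC b) -(act_dist (cut (e, true)) b ig) -cut_middle//.
  exact: (H3_dist_triangle (act (g e) (cut (e, true)))).
have delta0 d : dart_src (pi d : dart X) != t -> delta d = 0.
  move=> pdt; rewrite /delta Q'N// Qpi.
  by case: ifPn => [_|ld]; rewrite ?H3_distxx// cut_dist// subrr.
have delta_le d : dart_src (pi d : dart X) = t -> delta d <= H3_dist o o'.
  move=> pdt; have Qo : Q (dart_src d) = o by rewrite -Qpi pdt QC.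
  rewrite /delta {1 2}pdt /Q' eqxx; case: ifPn => [_|ld].
    by rewrite Qo H3_distC.
  rewrite lerBlDr -(cut_dist ld) Qo (H3_distC o o').
  exact: (H3_dist_triangle o o').
have deltaE d : ~~ short d.1 -> dart_src (pi d : dart X) = t ->
    delta d = H3_dist o' (cut d) - rho.
  by move=> ld pdt; rewrite /delta (negbTE ld) pdt /Q' eqxx.
apply: (le_trans (ler_sum _ (fun e _ => step e))).
rewrite big_split lerD2l /=.
have -> : \sum_e (delta (e, false) + delta (e, true)) = \sum_(d : edge X * bool) delta d.
  transitivity (\sum_e \sum_b delta (e, b)).
    by apply: eq_bigr => e _; rewrite big_bool /= addrC.
  by rewrite pair_bigA; apply: eq_bigr => -[].
rewrite (bigID (fun d : edge X * bool => dart_src (pi d : dart X) == t)) /=.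
rewrite [X in _ + X]big1 ?addr0; last by move=> d /delta0.
have srci : dart_src (pi (leg i) : dart X) = t by rewrite pii; case: alphaP.
have srcj : dart_src (pi (leg j) : dart X) = t by rewrite pij; case: betaP.
have card3 : #|[pred d : edge X * bool | dart_src (pi d : dart X) == t]| = 3%N.
  have := @rewire_trivalent X pi triv t; rewrite card_darts => <-.
  by apply: eq_card => d; rewrite !inE rewire_src.
have [_ li] := legP i; have [_ lj] := legP j.
have h := sum_over_three card3 (introT eqP srci) (introT eqP srcj) lij
  (fun d dt => delta_le d (elimT eqP dt)).
apply: (le_trans h); clear h.
rewrite !deltaE//; exact: star_gain_arith gain.
Qed.

End Surgery.

(** * Minimal length carrier graphs *)

Section Minimal.
Context (R : realType) (Gamma : kleinian R) (k : nat).
Local Notation G := (kleinian_set Gamma).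
Hypothesis Mk : forall x : manifold Gamma, pi1_rank R x k.
Context (X : carrier_graph Gamma).
Hypothesis minX : minimal_length X.

Local Notation dev P g := (developed (@cg_vertex _ _ X) (@cg_edge _ _ X) P g).
Local Notation dist P g e := (edge_dist g P e (e, false) (e, true)).

Lemma path_length_ge0 (p : R -> manifold Gamma) : (0 <= path_length p)%E.
Proof.
apply: (@le_trans _ _ (manifold_dist (p 0) (p 1))%:E).
  rewrite lee_fin; apply: lb_le_inf; last by move=> _ [[a b] _ <-]; exact: H3_dist_ge0.
  have [a pa] := pr_surj (p 0); have [b pb] := pr_surj (p 1).
  by exists (H3_dist a b); exists (a, b).
apply: ereal_sup_ubound; exists [:: 1]; first exact: (itv_partition1 ltr01).
by rewrite big_ord_recl big_ord0 addr0.
Qed.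

(** Straightening all edges cannot shorten a graph of minimal length. The
    straightened graph is of finite length, which excludes infinite lengths. *)
Lemma minimal_edge_length P g : dev P g ->
  (forall e, ((dist P g e)%:E <= edge_length e)%E) ->
  forall e : edge X, edge_length e = (dist P g e)%:E.
Proof.
move=> devP le_len; have [Gg _ _] := devP.
have [Z hZ] := competitor_exists (f := id) (f' := id) (phi := fun d => [:: d])
  (psi := fun d => [:: d]) P (g' := g) Mk devP (@cg_trivalent _ _ X)
  (fun _ => erefl) (fun _ => erefl) (fun _ => erefl) (fun _ => erefl)
  (fun _ => conj erefl erefl) (fun _ => conj erefl erefl)
  (fun _ => rst_refl _ _ _) Gg (fun d => mulr1 _).
have total : (\sum_(e : edge X) edge_length e <= (\sum_e dist P g e)%:E)%E.
  exact: le_trans (minX Z) hZ.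
have len0 (e : edge X) : (0 <= edge_length e)%E by exact: path_length_ge0.
have finE (e : edge X) : edge_length e \is a fin_num.
  rewrite ge0_fin_numE//; apply: le_lt_trans (ltry (\sum_e dist P g e)).
  by apply: le_trans total; rewrite (bigD1 e)//= leeDl// sume_ge0.
have lenE (e : edge X) : edge_length e = (fine (edge_length e))%:E by rewrite fineK.
move=> e; rewrite lenE; congr EFin; apply/eqP; rewrite eq_le.
have le_fine e' : dist P g e' <= fine (edge_length e').
  by rewrite -lee_fin -lenE.
rewrite le_fine andbT.
move: total; rewrite (eq_bigr (fun e => (fine (edge_length e))%:E)) => [|e' _]; last first.
  exact: lenE.
rewrite sumEFin lee_fin (bigD1 e)//= [leRHS](bigD1 e)//= => total.
rewrite -(lerD2r (\sum_(i | i != e) dist P g i)); apply: le_trans total.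
by rewrite lerD2l; apply: ler_sum.
Qed.

Lemma wvolt_tree (T : pred (edge X)) (g : edge X -> 'M[R]_4) w :
  (forall e, T e -> g e = 1) -> all (fun d : dart X => T d.1) w -> wvolt g w = 1.
Proof.
move=> gT; elim: w => [//|d w IH] /= /andP[Td /IH ->].
by rewrite mulr1 /volt gT//; case: d.2; rewrite ?invr1.
Qed.

Lemma minimal_rewire P g (pi : {perm (edge X * bool)})
    (T : pred (edge X)) (C : pred (vertex X)) (v0 : vertex X)
    (rho : vertex X -> seq (dart X)) (P' : vertex X -> H3 R) :
  dev P g -> (forall e : edge X, edge_length e = (dist P g e)%:E) ->
  (forall e, T e -> g e = 1) ->
  (forall d : dart X, T d.1 -> pi d = d) ->
  (forall d : dart X, dart_src (pi d : dart X) = dart_src d \/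
    C (dart_src d) /\ C (dart_src (pi d : dart X))) ->
  (forall v, all (fun d : dart X => T d.1) (rho v)) ->
  (forall v, C v -> is_walk v0 v (rho v)) ->
  (forall v, ~~ C v -> rho v = [::]) ->
  \sum_e dist P g e <= \sum_e edge_dist g P' e (pi (e, false)) (pi (e, true)).
Proof.
move=> devP lenE gT piT piC rhoT rhoC rhoN; have [Gg _ _] := devP.
have slideT := slide_tree pi rhoT.
have voltE d : wvolt g (to_rewire pi rho d : seq (dart X)) = volt g d.
  rewrite /to_rewire wvolt_cat (wvolt_tree gT (slideT d)) mul1r /=.
  rewrite (wvolt_rev Gg) (wvolt_tree gT (slideT (dart_flip d))) invr1.
  exact: mulr1.
have [Z hZ] := competitor_exists (Y := rewire pi) (f := id) (f' := id) P' (g' := g)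
  Mk devP (@rewire_trivalent X pi (@cg_trivalent _ _ X)) (fun _ => erefl) (fun _ => erefl)
  (to_rewire_flip pi rho) (of_rewire_flip (pi := pi) rho)
  (to_rewire_walk piT piC rhoT rhoC rhoN) (of_rewire_walk piC rhoC rhoN)
  (to_of_rewire piT rhoT) Gg voltE.
have := le_trans (minX Z) hZ.
rewrite /graph_length (eq_bigr (fun e => (dist P g e)%:E)) => [|e _]; last exact: lenE.
by rewrite sumEFin lee_fin.
Qed.

(** Lift the component [C] of [v0] in the forest [S] as a tree: each vertex is
    lifted to the end of the lift of a walk [rho v] from [v0] to it. Closed
    walks in a forest reduce to the empty walk, so that after this change the
    edges of the component have trivial deck transformations. *)
Lemma tree_gauge P g (S : pred (edge X)) (v0 : vertex X) : dev P g ->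
  (forall c : seq (dart X), is_circuit c -> ~~ all (fun d : dart X => S d.1) c) ->
  exists (C : pred (vertex X)) rho P' g', let T e := S e && C (source e) in
  [/\ dev P' g' /\ (forall e, dist P' g' e = dist P g e),
      forall e, T e -> g' e = 1,
      (forall v, all (fun d : dart X => T d.1) (rho v)) /\
        (forall v, size (rho v) < #|vertex X|)%N,
      (forall v, C v -> is_walk v0 v (rho v)) /\ (forall v, ~~ C v -> rho v = [::]) &
      (forall v w, is_walk v0 v w -> all (fun d : dart X => S d.1) w -> C v) /\
      (forall d : dart X, S d.1 -> C (dart_src d) -> C (dart_tgt d))].
Proof.
move=> devP acyc; have [Gg _ _] := devP.
pose C v := `[< exists w, [/\ is_walk v0 v w, reduced w &
  all (fun d : dart X => S d.1) w] >].
have C_walk v w : is_walk v0 v w -> all (fun d : dart X => S d.1) w -> C v.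
  move=> hw Sw; have [w' [h1 h2 _ h3]] := reduce_walk hw.
  apply/asboolP; exists w'; split=> //; apply/allP => d /h3.
  by move/allP: Sw; apply.
have : forall v, exists w, (C v -> [/\ is_walk v0 v w, reduced w &
    all (fun d : dart X => S d.1) w]) /\ (~~ C v -> w = [::]).
  move=> v; have [/asboolP[w hw]|Cv] := boolP (C v); first by exists w.
  by exists [::].
move=> /choice[rho Hrho].
have CS (d : dart X) : S d.1 -> C (dart_src d) -> C (dart_tgt d).
  move=> Sd Cd; have [/(_ Cd)[h1 _ h2] _] := Hrho (dart_src d).
  apply: (C_walk _ (rho (dart_src d) ++ [:: d])).
    by apply: (is_walk_cat h1); split.
  by rewrite all_cat h2 /= Sd.
pose T e := S e && C (source e).
have T_walk u v w : C u -> is_walk u v w -> all (fun d : dart X => S d.1) w ->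
    all (fun d : dart X => T d.1) w.
  elim: w u => [//|d w IH] u Cu /= [du hw] /andP[Sd Sw].
  rewrite -du in Cu; have Ct := CS d Sd Cu.
  rewrite (IH _ Ct hw Sw) andbT /T Sd /=.
  by case: d Sd {du hw} Cu Ct => e [].
have Cv0 : C v0 by apply: (C_walk _ [::]).
pose h v := wvolt g (rho v).
have Gh v : G (h v) := wvolt_mem Gg (rho v).
have [devP' actE] := developed_gauge devP Gh.
exists C, rho, (fun v => act (h v) (P v)),
  (fun e => h (source e) * g e * (h (target e))^-1); split.
- split=> // e; rewrite /edge_dist /dart_src /= actE act_dist//.
  exact: kleinian_isom.
- move=> e /andP[Se Cs]; have Ct := CS (e, false) Se Cs.
  have [/(_ Cs)[s1 _ s2] _] := Hrho (source e).
  have [/(_ Ct)[t1 _ t2] _] := Hrho (dart_tgt ((e, false) : dart X)).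
  pose w := rho (source e) ++ (e, false) :: walk_rev (rho (target e)).
  have hw : is_walk v0 v0 w.
    by apply: (is_walk_cat s1); split=> //; exact: is_walk_rev.
  have Sw : all (fun d : dart X => S d.1) w.
    rewrite all_cat s2 /= Se /= /walk_rev all_rev all_map; exact: t2.
  have [w' [w1 w2 w3 w4]] := reduce_walk hw.
  have w'0 : w' = [::].
    apply: (forest_closed_walk acyc w1 w2); apply/allP => d /w4.
    by move/allP: Sw; apply.
  have : wvolt g w = 1 by rewrite (wvolt_homotopic Gg w3) w'0.
  by rewrite /w wvolt_cat /= (wvolt_rev Gg) mulrA.
- split=> v; have [h1 h2] := Hrho v.
    have [/h1[w1 _ w3]|/h2 ->//] := boolP (C v).
    exact: (T_walk _ _ _ Cv0 w1 w3).
  have [/h1[w1 w2 w3]|/h2 ->] := boolP (C v).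
    exact: (forest_walk_size acyc w1 w2 w3).
  by apply/card_gt0P; exists v.
- by split=> v Cv; have [h1 h2] := Hrho v; [case: (h1 Cv)|exact: h2].
- by split.
Qed.

End Minimal.

(** * Short edges *)

(** The scales from [a / K ^+ j.+1] to [a / K ^+ j] are disjoint, and there are
    more of them than numbers [D i]. *)
Lemma scale_gap (R : realType) (I : finType) (D : I -> R) (K a : R) N :
  1 < K -> 0 < a -> (#|I| < N)%N ->
  exists s, [/\ a / K ^+ N <= s, K * s <= a &
    forall i, D i < s \/ K * s <= D i].
Proof.
move=> K1 a0 IN; have K0 : 0 < K by lra.
pose s (j : 'I_N) := a / K ^+ j.+1.
have Ks j : K * s j = a / K ^+ j.
  by rewrite /s exprS invfM mulrCA mulVKf// gt_eqF.
apply: contrapT => H.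
have : forall j, exists i, s j <= D i < K * s j.
  move=> j; apply: contrapT => h; apply: H; exists (s j); split.
  - by rewrite ler_pM2l// lef_pV2 ?posrE ?exprn_gt0// ler_weXn2l// ltW.
  - by rewrite Ks ler_pdivrMr ?exprn_gt0// ler_peMr ?(ltW a0)// exprn_ege1// ltW.
  - move=> i; have [_|l1] := ltP (D i) (s j); [by left|right].
    by rewrite leNgt; apply/negP => l2; apply: h; exists i; rewrite l1.
move=> /choice[f Hf].
have lt_neq (j j' : 'I_N) : (j < j')%N -> f j != f j'.
  move=> jj; apply/eqP => e.
  have /andP[l1 _] := Hf j; have /andP[_ l2] := Hf j'.
  have : K * s j' <= s j.
    by rewrite Ks ler_pM2l// lef_pV2 ?posrE ?exprn_gt0// ler_weXn2l// ltW.
  by rewrite leNgt => /negP; apply; apply: le_lt_trans l1 _; rewrite e.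
have /leq_card : injective f.
  move=> j j' e; apply/val_inj/eqP; rewrite -[_ == _]negbK neq_ltn negb_or.
  by apply/andP; split; apply/negP => /lt_neq; rewrite e eqxx.
by rewrite card_ord leqNgt IN.
Qed.

Lemma leaf_other_darts (X : graph) (S : pred (edge X)) (s : dart X) :
  trivalent X -> (forall d : dart X, S d.1 -> dart_src d = dart_src s -> d = s) ->
  exists a b : dart X, [/\ a != b, dart_src a = dart_src s /\ ~~ S a.1 &
    dart_src b = dart_src s /\ ~~ S b.1].
Proof.
move=> triv uniq_s.
pose A := [set d : edge X * bool | dart_src (d : dart X) == dart_src s]%SET.
have A3 : #|A| = 3%N by rewrite -(triv (dart_src s)) card_darts.
have : #|(A :\ (s : edge X * bool))%SET| == 2%N.
  by have := cardsD1 (s : edge X * bool) A; rewrite A3 inE eqxx add1n => -[<-].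
move=> /cards2P[a [b [ab AE]]]; exists a, b.
have mem x : x \in [set a; b]%SET -> dart_src (x : dart X) = dart_src s /\ ~~ S x.1.
  rewrite -AE !inE => /andP[xs /eqP xv]; split=> //; apply/negP => Sx.
  by rewrite (uniq_s x Sx xv) eqxx in xs.
by split=> //; apply: mem; rewrite !inE eqxx ?orbT.
Qed.

Lemma edge_dist_close (R : realType) (Gamma : kleinian R) (X : graph)
    (g : edge X -> 'M[R]_4) (Q P : vertex X -> H3 R) (eta : R) e d1 d2 :
  kleinian_set Gamma (g e) -> (forall v, H3_dist (Q v) (P v) <= eta) ->
  edge_dist g Q e d1 d2 <= edge_dist g P e d1 d2 + 2 * eta.
Proof.
move=> Gg close; rewrite /edge_dist; have ig := kleinian_isom Gg.
set a := dart_src d1; set b := dart_src d2.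
have := H3_dist_triangle (P a) (Q a) (act (g e) (Q b)).
have := H3_dist_triangle (act (g e) (P b)) (P a) (act (g e) (Q b)).
rewrite act_dist// (H3_distC (P b) (Q b)).
have := close a; have := close b; lra.
Qed.

(** With at most [3 * k] edges and [2 * k] vertices, collapsing the component
    lengthens the graph by at most [12 * k ^ 2 * s]; the gain from the star is
    [K * s / 8000]. *)
Lemma gap_arith (R : realType) (k n m s : R) :
  1 <= k -> 0 <= n -> n <= 3 * k -> 0 <= m -> m <= 2 * k -> 0 < s ->
  let K := 2000 * 50 * k ^+ 2 in
  [/\ 0 < K * s / 4, 2 * (2 * (m * s)) <= K * s &
    n * (2 * (m * s)) < K * s / 4 / 2000].
Proof.
move=> k1 n0 nk m0 mk s0 K.
have kk : k <= k ^+ 2 by rewrite expr2 ler_peMl//; lra.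
have nm : n * m <= (3 * k) * (2 * k) by apply: ler_pM.
have ks0 : 0 < k ^+ 2 * s by rewrite mulr_gt0// exprn_gt0//; lra.
split; first by rewrite /K; lra.
  have h : m * s <= 2 * k ^+ 2 * s by rewrite ler_pM2r//; lra.
  by rewrite /K; lra.
have h : n * m * s <= (3 * k) * (2 * k) * s by rewrite ler_pM2r.
have -> : n * (2 * (m * s)) = 2 * (n * m * s) by ring.
have : (3 * k) * (2 * k) * s = 6 * (k ^+ 2 * s) by ring.
by rewrite /K; lra.
Qed.

Lemma quarter_arith (R : realType) (a : R) : a <= 2 -> a / 4 <= 2^-1.
Proof. lra. Qed.

Lemma long_arith (R : realType) (a b c L : R) :
  2 * (2 * c) <= a -> a <= b -> b <= L + 2 * c -> 2 * (a / 4) <= L.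
Proof. lra. Qed.

Section ShortEdges.
Context (R : realType) (Gamma : kleinian R) (k : nat).
Hypothesis k_gt0 : (0 < k)%N.
Hypothesis Mk : forall x : manifold Gamma, pi1_rank R x k.
Context (X : carrier_graph Gamma) (r s : R).
Hypothesis minX : minimal_length X.
Hypothesis circuits : forall c : seq (dart X), is_circuit c ->
  (r%:E < circuit_length c)%E.
Hypothesis s_gt0 : 0 < s.

Local Notation n := #|edge X|.
Local Notation m := #|vertex X|.
Local Notation dev P g := (developed (@cg_vertex _ _ X) (@cg_edge _ _ X) P g).
Local Notation dist P g e := (edge_dist g P e (e, false) (e, true)).

Lemma card_edges : (n <= 3 * k)%N.
Proof.
have [V0 _] := @cg_connected _ _ X; have /card_gt0P[v _] := V0.
apply: (@trivalent_rank_card X v); [exact: cg_connected|exact: cg_trivalent|].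
by apply/cg_rank; exact: Mk.
Qed.

Lemma card_vertices : (m <= 2 * k)%N.
Proof. by have := card_edges; have := trivalent_card (@cg_trivalent _ _ X); lia. Qed.

(** A circuit has at most [3 * k] edges. *)
Lemma short_edges_acyclic (S : pred (edge X)) :
  (forall e, S e -> (edge_length e <= s%:E)%E) -> (3 * k)%:R * s <= r ->
  forall c : seq (dart X), is_circuit c -> ~~ all (fun d : dart X => S d.1) c.
Proof.
move=> Ss hr c circ; apply/negP => Sc.
have [_ _ _ uc] := circ; have := circuits circ.
rewrite ltNge => /negP; apply.
apply: (@le_trans _ _ (\sum_(d <- c) s%:E)%E).
  rewrite /circuit_length big_seq [leRHS]big_seq; apply: lee_sum => d dc.
  by apply: Ss; move/allP: Sc; apply.
rewrite sumEFin lee_fin; apply: le_trans hr.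
have -> : \sum_(d <- c) s = (size c)%:R * s.
  by rewrite big_const_seq count_predT iter_addr_0 mulr_natl.
rewrite ler_pM2r// ler_nat.
rewrite -(size_map fst); apply: leq_trans card_edges.
by move/card_uniqP: uc => <-; exact: max_card.
Qed.

Context (P : vertex X -> H3 R) (g : edge X -> 'M[R]_4).
Hypothesis devP : dev P g.
Hypothesis lenE : forall e : edge X, edge_length e = (dist P g e)%:E.

(** The component of a short edge is collapsed to a point and then rewired at
    one of its leaves. *)
Lemma no_short_edge (K := 2000 * 50 * (k%:R : R) ^+ 2) :
  (3 * k)%:R * s <= r -> K * s <= 2 ->
  (forall e, dist P g e < s \/ K * s <= dist P g e) ->
  forall e, s <= dist P g e.
Proof.
move=> hr hK gap e0; rewrite leNgt; apply/negP => e0s.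
pose S e := dist P g e < s.
have acyc : forall c : seq (dart X), is_circuit c ->
    ~~ all (fun d : dart X => S d.1) c.
  by apply: short_edges_acyclic => // e Se; rewrite lenE lee_fin ltW.
pose v0 := source e0.
have [s1 [Ss1 _ [w1 hw1 Sw1] leaf1]] := forest_leaf acyc (d0 := (e0, false)) e0s.
have [s2 [_ s21 [w2 hw2 Sw2] leaf2]] := forest_leaf acyc Ss1.
have [C [rho [P' [g' [[devP' distE] gT [rhoT rho_size] [rhoC rhoN] [CW _]]]]]] :=
  tree_gauge v0 devP acyc.
have [Gg' _ _] := devP'.
have Cs1 : C (dart_src s1) by apply: CW hw1 Sw1.
have Cs2 : C (dart_src s2).
  by apply: (CW _ (w1 ++ w2)); [exact: is_walk_cat hw1 hw2|rewrite all_cat Sw1].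
have triv := @cg_trivalent _ _ X.
have [a1 [b1 [ab1 [a1v a1S] [b1v b1S]]]] := leaf_other_darts triv leaf1.
have [a2 [b2 [ab2 [a2v a2S] [b2v b2S]]]] := leaf_other_darts triv leaf2.
pose legs := [tuple of [:: a1; b1; a2; b2 : edge X * bool]].
have legs_inj : injective (tnth legs).
  apply/tuple_uniqP; rewrite /= !inE !negb_or ab1 ab2 !andbT /=.
  have ne x y : dart_src (x : dart X) = dart_src s1 ->
      dart_src (y : dart X) = dart_src s2 -> x != y.
    by move=> xv yv; apply: contra s21 => /eqP xy; rewrite -yv -xy xv.
  by rewrite !ne.
have legsP i : C (dart_src (tnth legs i : dart X)) /\ ~~ S (tnth legs i).1.
  have : tnth legs i \in legs by exact: mem_tnth.
  rewrite !inE => /or4P[] /eqP ->.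
  - by rewrite a1v.
  - by rewrite b1v.
  - by rewrite a2v.
  - by rewrite b2v.
pose T e := S e && C (source e).
have step (d : dart X) : T d.1 -> H3_dist (P' (dart_src d)) (P' (dart_tgt d)) <= s.
  move=> Td; have /andP[Sd _] := Td; apply: ltW; apply: le_lt_trans Sd.
  rewrite -distE /edge_dist gT// act1.
  by case: d Td => e [] _; rewrite // H3_distC.
have walk_dist w u v : is_walk u v w -> all (fun d : dart X => T d.1) w ->
    H3_dist (P' u) (P' v) <= (size w)%:R * s.
  elim: w u => [|d w IH] u /=; first by move=> -> _; rewrite H3_distxx mul0r.
  move=> [<- hw] /andP[/step h1 /(IH _ hw) h2].
  apply: le_trans (H3_dist_triangle (P' (dart_tgt d)) _ _) _.
  by rewrite -natr1 mulrDl mul1r addrC lerD.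
pose o := P' v0.
pose Q v := if C v then o else P' v.
have QC v : C v -> Q v = o by rewrite /Q => ->.
have QP v : H3_dist (Q v) (P' v) <= m%:R * s.
  rewrite /Q; have [Cv|_] := boolP (C v); last first.
    by rewrite H3_distxx mulr_ge0 ?ler0n// ltW.
  apply: le_trans (walk_dist _ _ _ (rhoC v Cv) (rhoT v)) _.
  by rewrite ler_pM2r// ler_nat ltnW.
have len_le e : dist Q g' e <= dist P g e + 2 * (m%:R * s).
  by rewrite -distE; exact: edge_dist_close.
have len_ge e : dist P g e <= dist Q g' e + 2 * (m%:R * s).
  by rewrite -distE; apply: edge_dist_close => // v; rewrite H3_distC.
have k1 : 1 <= k%:R :> R by rewrite ler1n.
have mk : (m%:R : R) <= 2 * k%:R by rewrite -natrM ler_nat card_vertices.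
have nk : (n%:R : R) <= 3 * k%:R by rewrite -natrM ler_nat card_edges.
have [rad0 gap1 gap2] := gap_arith k1 (ler0n _ n) nk (ler0n _ m) mk s_gt0.
pose rad := K * s / 4.
have rad_le : rad <= 2^-1 by exact: quarter_arith hK.
have long e : ~~ S e -> 2 * rad <= dist Q g' e.
  move=> Se; apply: long_arith gap1 _ (len_ge e).
  by case: (gap e) => // h; rewrite /S h in Se.
have [pi [Q' [piS piC shorter]]] := surgery Gg' QC triv rad0 rad_le long Cs1 ab1
  (conj a1v a1S) (conj b1v b1S) legs_inj legsP.
have lenE' (e : edge X) : edge_length e = (dist P' g' e)%:E by rewrite distE.
have piT d : T d.1 -> pi d = d by move=> /andP[/piS].
have := minimal_rewire Mk minX Q' devP' lenE' gT piT piC rhoT rhoC rhoN.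
move=> /le_trans /(_ shorter); rewrite leNgt => /negP; apply.
rewrite ltrBlDr; apply: le_lt_trans (_ : \sum_e (dist P g e + 2 * (m%:R * s)) < _).
  by apply: ler_sum => e _; exact: len_le.
rewrite big_split /= sumr_const -[X in _ + X]mulr_natl.
rewrite [X in _ < X + _](eq_bigr (fun e => dist P g e)); last by move=> e _; exact: distE.
by rewrite ltrD2l.
Qed.

End ShortEdges.

Theorem theorem2 (R : realType) (k : nat) (r : R) :
  (1 < k)%N -> 0 < r ->
  exists l : R, 0 < l /\
    forall Gamma : kleinian R,
      (forall x : manifold Gamma, pi1_rank R x k) ->
      forall X : carrier_graph Gamma,
        minimal_length X ->
        (forall c : seq (dart X), is_circuit c -> (r%:E < circuit_length c)%E) ->
        forall e : edge X, (l%:E <= edge_length e)%E.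
Proof.
move=> k1 r0; have k0 : (0 < k)%N by exact: ltnW.
pose K : R := 2000 * 50 * k%:R ^+ 2.
have kR : 1 <= k%:R :> R by rewrite ler1n.
have kk : k%:R <= k%:R ^+ 2 :> R by rewrite expr2 ler_peMl//; lra.
have K1 : 1 < K by rewrite /K; lra.
have K0 : 0 < K by lra.
(* [a <= r] makes circuits too long to consist of short edges; [a <= 1] keeps
   the radius of the stars in the range of [star_split] *)
pose a := Num.min 1 r.
have a0 : 0 < a by rewrite lt_min ltr01.
exists (a / K ^+ (3 * k).+1); split; first by rewrite divr_gt0// exprn_gt0.
move=> Gamma Mk X minX circuits e.
have [P [g [devP len_le]]] := development_exists X.
have lenE := minimal_edge_length Mk minX devP len_le.
have [|s [sl sa gap]] := scale_gap (N := (3 * k).+1)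
  (fun e => edge_dist g P e (e, false) (e, true)) K1 a0.
  by rewrite ltnS; exact: (card_edges Mk).
have s0 : 0 < s by apply: lt_le_trans sl; rewrite divr_gt0// exprn_gt0.
rewrite lenE lee_fin; apply: le_trans sl _.
have a1 : a <= 1 by rewrite ge_min lexx.
have ar : a <= r by rewrite ge_min lexx orbT.
apply: (no_short_edge k0 Mk minX circuits s0 devP lenE _ _ gap).
  apply: le_trans ar; apply: le_trans sa; rewrite ler_pM2r// natrM /K; lra.
by apply: le_trans sa _; lra.
Qed.
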